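(* In the setting below, suppose $Q=q I$ is a scalar matrix, with $q\in\mathbb Z_\ell$, $q\equiv 1\pmod\ell$, $q\neq1$. Let $v\in\mathbb Z_\ell^b$ be primitive. For every $n$ such that $k_{n+1}=\ell k_n$, the characteristic polynomials satisfy $$p_{n+1,v}(y)\equiv p_{n,v}(y)\pmod{k_{n+1}},$$ i.e. all coefficients of $p_{n+1,v}(y)-p_{n,v}(y)$ lie in $k_{n+1}\mathbb Z_\ell[\zeta_{\ell^{n+1}}]$.
   Context: $\ell$ is an odd prime, $b,r\ge1$, $\Lambda=\mathbb Z_\ell[[T_1,\dots,T_b]]$, $t_i=1+T_i$. Fix primitive $\ell^n$-th roots of unity $\zeta_{\ell^n}\in\overline{\mathbb Q}_\ell$ with $\zeta_{\ell^{n+1}}^\ell=\zeta_{\ell^n}$. $Q\in\mathrm{GL}_b(\mathbb Z_\ell)$ satisfies $Q\equiv I\pmod\ell$ and fixes no nonzero vector. A vector $v\in\mathbb Z_\ell^b$ is primitive if some coordinate is a unit; $k_n(v)$ is the least positive integer $k$ with $Q^kv\equiv v\pmod{\ell^n}$, and $k_n=\min_{v\text{ primitive}}k_n(v)$. Let $F=F(T_1,\dots,T_b)\in\mathrm{GL}_r(\Lambda)$. For $w\in\mathbb Z_\ell^b$ write $F(\zeta_{\ell^n}^w)$ for the matrix obtained by substituting $T_i=\zeta_{\ell^n}^{w_i}-1$ (the power series converge in $\mathbb Z_\ell[\zeta_{\ell^n}]$). Define $$A_n(v)=F(\zeta_{\ell^n}^{Q^{k_n(v)-1}v})\cdots F(\zeta_{\ell^n}^{Qv})\,F(\zeta_{\ell^n}^{v}),\qquad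 p_{n,v}(y)=\det(I-yA_n(v)).$$ *)

(* Defs.v *)
From HB Require Import structures.
From mathcomp Require Import all_boot all_order all_algebra.
From mathcomp Require Import boolp classical_sets.
From mathcomp Require Import mpoly.

Set Implicit Arguments.
Unset Strict Implicit.
Unset Printing Implicit Defensive.

Import GRing.Theory.
Local Open Scope ring_scope.

Section ClassicalInverse.
Variable R : comNzRingType.

Definition cl_unit : pred R := fun x => `[< exists y, y * x = 1 >].
Definition cl_inv (x : R) : R := xget x [set y | y * x = 1]%classic.

Lemma cl_mulVr : {in cl_unit, left_inverse 1 cl_inv *%R}.
Proof. by move=> x /asboolP ex; rewrite /cl_inv; case: xgetP => // /(_ _) H; case: ex => y /H. Qed.

Lemma cl_unitPl (x y : R) : y * x = 1 -> cl_unit x.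
Proof. by move=> yx; apply/asboolP; exists y. Qed.

Lemma cl_invr_out : {in [predC cl_unit], cl_inv =1 id}.
Proof.
move=> x /negP xN; rewrite /cl_inv; case: xgetP => // y _ yx.
by case: xN; apply: cl_unitPl yx.
Qed.
End ClassicalInverse.

(* Z_l as the inverse limit of the Z/l^n: [residue x n] is the representative  *)
(* of x mod l^n in [0, l^n[, the bound being implied by [residueP].            *)
Record padic_int (l : nat) (pl : prime l) := PadicInt {
  residue : nat -> nat;
  residueP : forall n, (residue n.+1 %% l ^ n)%N = residue n }.

HB.instance Definition _ l (pl : prime l) := gen_eqMixin (padic_int pl).
HB.instance Definition _ l (pl : prime l) := gen_choiceMixin (padic_int pl).

Section PadicRing.
Variables (l : nat) (pl : prime l).
Local Notation Zl := (padic_int pl).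
Implicit Types x y z : Zl.
Local Open Scope nat_scope.

Lemma padic_eqP x y : (forall n, residue x n = residue y n) -> x = y.
Proof.
case: x y => [f fP] [g gP] /= fg; have {}fg : f = g by apply: funext.
by subst g; congr PadicInt; apply: Prop_irrelevance.
Qed.

Lemma residueS x n : residue x n.+1 = residue x n %[mod l ^ n].
Proof. by rewrite -(residueP x n) modn_mod. Qed.

Lemma residue_mod x n : residue x n %% l ^ n = residue x n.
Proof. by rewrite -(residueP x n) modn_mod. Qed.

Lemma residueD x n k : residue x (n + k) %% l ^ n = residue x n.
Proof.
elim: k => [|k IH]; first by rewrite addn0 residue_mod.
rewrite addnS -IH -(residueP x (n + k)) modn_dvdm //.
by rewrite expnD dvdn_mulr.
Qed.

Section Mk.
Variables (f : nat -> nat) (fP : forall n, f n.+1 = f n %[mod l ^ n]).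
Fact mk_padic_subproof n : ((f n.+1 %% l ^ n.+1) %% l ^ n = f n %% l ^ n).
Proof. by rewrite modn_dvdm ?fP // expnS dvdn_mull. Qed.
Definition mk_padic : Zl := PadicInt pl mk_padic_subproof.
End Mk.

Fact padic_nat_subproof (a : nat) n : a = a %[mod l ^ n]. Proof. by []. Qed.
Definition padic_nat a : Zl := mk_padic (padic_nat_subproof a).

Fact padic_add_subproof x y n :
  residue x n.+1 + residue y n.+1 = residue x n + residue y n %[mod l ^ n].
Proof. by rewrite -modnDm !residueP. Qed.
Definition padic_add x y := mk_padic (padic_add_subproof x y).

Fact padic_mul_subproof x y n :
  residue x n.+1 * residue y n.+1 = residue x n * residue y n %[mod l ^ n].
Proof. by rewrite -modnMm !residueP. Qed.
Definition padic_mul x y := mk_padic (padic_mul_subproof x y).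

Lemma pl_gt0 n : 0 < l ^ n. Proof. by rewrite expn_gt0 prime_gt0. Qed.

Lemma residue_le x n : residue x n <= l ^ n.
Proof. by rewrite -(residue_mod x n) ltnW // ltn_mod pl_gt0. Qed.

Fact padic_opp_subproof x n :
  l ^ n.+1 - residue x n.+1 = l ^ n - residue x n %[mod l ^ n].
Proof.
apply/eqP; rewrite -(eqn_modDr (residue x n)) subnK ?residue_le // modnn.
rewrite -(residueP x n) modnDmr subnK ?residue_le //.
by rewrite expnS modnMl.
Qed.
Definition padic_opp x := mk_padic (padic_opp_subproof x).

Fact padic_addA : associative padic_add.
Proof. by move=> x y z; apply/padic_eqP => n /=; rewrite modnDmr modnDml addnA. Qed.
Fact padic_addC : commutative padic_add.
Proof. by move=> x y; apply/padic_eqP => n /=; rewrite addnC. Qed.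
Fact padic_add0 : left_id (padic_nat 0) padic_add.
Proof. by move=> x; apply/padic_eqP => n /=; rewrite mod0n add0n residue_mod. Qed.
Fact padic_addN : left_inverse (padic_nat 0) padic_opp padic_add.
Proof.
move=> x; apply/padic_eqP => n /=.
by rewrite modnDml subnK ?residue_le // modnn mod0n.
Qed.

HB.instance Definition _ :=
  GRing.isZmodule.Build Zl padic_addA padic_addC padic_add0 padic_addN.

Fact padic_mulA : associative padic_mul.
Proof. by move=> x y z; apply/padic_eqP => n /=; rewrite modnMmr modnMml mulnA. Qed.
Fact padic_mulC : commutative padic_mul.
Proof. by move=> x y; apply/padic_eqP => n /=; rewrite mulnC. Qed.
Fact padic_mul1 : left_id (padic_nat 1) padic_mul.
Proof. by move=> x; apply/padic_eqP => n /=; rewrite modnMml mul1n residue_mod. Qed.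
Fact padic_mulD : left_distributive padic_mul padic_add.
Proof.
by move=> x y z; apply/padic_eqP => n /=; rewrite modnMml modnDm mulnDl.
Qed.
Fact padic_1neq0 : padic_nat 1 != padic_nat 0.
Proof.
apply/eqP => /(congr1 (fun x => residue x 1)) /=.
by rewrite mod0n modn_small // expn1 prime_gt1.
Qed.

HB.instance Definition _ := GRing.Zmodule_isComNzRing.Build Zl
  padic_mulA padic_mulC padic_mul1 padic_mulD padic_1neq0.

HB.instance Definition _ := GRing.ComNzRing_hasMulInverse.Build Zl
  (@cl_mulVr Zl) (@cl_unitPl Zl) (@cl_invr_out Zl).

Lemma padic_neq0P x : x != 0%R -> exists n, ~~ (l ^ n %| residue x n).
Proof.
move=> x0; apply: contrapT => /forallNP H; case/negP: x0; apply/eqP.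
apply/padic_eqP => n /=; have /negP := H n; rewrite negbK /dvdn residue_mod.
by move/eqP->; rewrite mod0n.
Qed.

Fact padic_integral : GRing.integral_domain_axiom Zl.
Proof.
move=> x y xy0; case: eqVneq => //= /padic_neq0P[n xn].
apply: contraT => /padic_neq0P[m ym].
have xN : ~~ (l ^ n %| residue x (n + m)) by rewrite /dvdn residueD -(residue_mod x n).
have yM : ~~ (l ^ m %| residue y (n + m)).
  by rewrite addnC /dvdn residueD -(residue_mod y m).
have x_gt0 : 0 < residue x (n + m) by case: (residue x _) xN; rewrite // dvdn0.
have y_gt0 : 0 < residue y (n + m) by case: (residue y _) yM; rewrite // dvdn0.
have : l ^ (n + m) %| residue x (n + m) * residue y (n + m).
  have /(congr1 (fun z => residue z (n + m))) := xy0.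
  by rewrite /= mod0n => /eqP.
move: xN yM; rewrite !pfactor_dvdn ?muln_gt0 ?x_gt0 // lognM // -!ltnNge.
by move=> h1 h2; rewrite leqNgt -addSn leq_add // ltnW.
Qed.

HB.instance Definition _ := GRing.ComUnitRing_isIntegral.Build Zl padic_integral.
End PadicRing.

(* R[[T_1, ..., T_b]] *)
Record mpseries (b : nat) (R : Type) := MPSeries { mpcoef : 'X_{1..b} -> R }.

HB.instance Definition _ b (R : Type) := gen_eqMixin (mpseries b R).
HB.instance Definition _ b (R : Type) := gen_choiceMixin (mpseries b R).

Section SeriesRing.
Variables (b : nat) (R : comNzRingType).
Local Notation S := (mpseries b R).
Implicit Types f g h : S.

Lemma mpseriesP f g : (forall m, mpcoef f m = mpcoef g m) -> f = g.
Proof. by case: f g => f [g] /= fg; congr MPSeries; apply: funext. Qed.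

Definition mpseries0 : S := MPSeries (fun=> 0).
Definition mpseries1 : S := MPSeries (fun m => (m == 0%MM)%:R).
Definition mpseries_add f g : S := MPSeries (fun m => mpcoef f m + mpcoef g m).
Definition mpseries_opp f : S := MPSeries (fun m => - mpcoef f m).
Definition mpseries_mul f g : S := MPSeries (fun m =>
  \sum_(k : 'X_{1..b < (mdeg m).+1, (mdeg m).+1} | m == (k.1 + k.2)%MM)
    mpcoef f k.1 * mpcoef g k.2).

(* the part of f of total degree < N *)
Definition mptrunc (N : nat) f : {mpoly R[b]} :=
  \sum_(m : 'X_{1..b < N}) mpcoef f m *: 'X_[m].

Lemma mcoeff_trunc N f m : (mdeg m < N)%N -> (mptrunc N f)@_m = mpcoef f m.
Proof.
move=> mN; rewrite raddf_sum /= (bigD1 (BMultinom mN)) //=.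
rewrite mcoeffZ mcoeffX eqxx mulr1 big1 ?addr0 // => k km.
rewrite mcoeffZ mcoeffX; case: eqP => [kmE|_]; last by rewrite mulr0.
by case/eqP: km; apply/val_inj.
Qed.

Lemma eq_mcoeffM (p p' q q' : {mpoly R[b]}) m :
  (forall k, (mdeg k < (mdeg m).+1)%N -> p@_k = p'@_k) ->
  (forall k, (mdeg k < (mdeg m).+1)%N -> q@_k = q'@_k) ->
  (p * q)@_m = (p' * q')@_m.
Proof.
move=> pp qq; rewrite !mcoeffM; apply: eq_bigr => -[k1 k2] _ /=.
by rewrite pp ?qq ?bmdeg.
Qed.

Lemma mpcoefM N f g m : (mdeg m < N)%N ->
  mpcoef (mpseries_mul f g) m = (mptrunc N f * mptrunc N g)@_m.
Proof.
move=> mN; rewrite mcoeffM /=; apply: eq_bigr => -[k1 k2] _ /=.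
by rewrite !mcoeff_trunc // (leq_trans (bmdeg _)).
Qed.

Fact mpseries_addA : associative mpseries_add.
Proof. by move=> f g h; apply/mpseriesP => m /=; rewrite addrA. Qed.
Fact mpseries_addC : commutative mpseries_add.
Proof. by move=> f g; apply/mpseriesP => m /=; rewrite addrC. Qed.
Fact mpseries_add0 : left_id mpseries0 mpseries_add.
Proof. by move=> f; apply/mpseriesP => m /=; rewrite add0r. Qed.
Fact mpseries_addN : left_inverse mpseries0 mpseries_opp mpseries_add.
Proof. by move=> f; apply/mpseriesP => m /=; rewrite addNr. Qed.

HB.instance Definition _ := GRing.isZmodule.Build S
  mpseries_addA mpseries_addC mpseries_add0 mpseries_addN.

Fact mpseries_mulA : associative mpseries_mul.
Proof.
move=> f g h; apply/mpseriesP => m.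
rewrite !(@mpcoefM (mdeg m).+1) //.
transitivity ((mptrunc (mdeg m).+1 f * mptrunc (mdeg m).+1 g
                 * mptrunc (mdeg m).+1 h)@_m).
  rewrite -mulrA; apply: eq_mcoeffM => // k km.
  by rewrite mcoeff_trunc // (mpcoefM _ _ km).
apply: eq_mcoeffM => // k km.
by rewrite mcoeff_trunc // (mpcoefM _ _ km).
Qed.
Fact mpseries_mulC : commutative mpseries_mul.
Proof.
by move=> f g; apply/mpseriesP => m; rewrite !(@mpcoefM (mdeg m).+1) // mulrC.
Qed.
Fact mpseries_mul1 : left_id mpseries1 mpseries_mul.
Proof.
move=> f; apply/mpseriesP => m; rewrite (@mpcoefM (mdeg m).+1) //.
rewrite -[RHS](@mcoeff_trunc (mdeg m).+1) // -[in RHS](mul1r (mptrunc _ _)).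
by apply: eq_mcoeffM => // k km; rewrite mcoeff_trunc // mcoeff1.
Qed.
Fact mpseries_mulD : left_distributive mpseries_mul mpseries_add.
Proof.
move=> f g h; apply/mpseriesP => m /=; rewrite -big_split /=.
by apply: eq_bigr => k _; rewrite mulrDl.
Qed.
Fact mpseries_1neq0 : mpseries1 != mpseries0.
Proof.
by apply/eqP => /(congr1 (fun f => mpcoef f 0%MM)) /eqP /=; rewrite eqxx oner_eq0.
Qed.

HB.instance Definition _ := GRing.Zmodule_isComNzRing.Build S
  mpseries_mulA mpseries_mulC mpseries_mul1 mpseries_mulD mpseries_1neq0.

HB.instance Definition _ := GRing.ComNzRing_hasMulInverse.Build S
  (@cl_mulVr S) (@cl_unitPl S) (@cl_invr_out S).
End SeriesRing.

Definition eqmod (R : pzRingType) (a x y : R) := exists c, x - y = a * c.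
Definition eqmodmx (R : pzRingType) m n (a : R) (A B : 'M[R]_(m, n)) :=
  forall i j, eqmod a (A i j) (B i j).

(* 0 by convention when P is empty *)
Definition least (P : set nat) : nat :=
  xget 0%N [set k | P k /\ forall j, P j -> (k <= j)%N]%classic.

Section Orders.
Variables (l : nat) (pl : prime l) (b : nat).
Local Notation Zl := (padic_int pl).

Definition primitive (v : 'cV[Zl]_b) := exists i, v i 0 \is a GRing.unit.

Definition kord (Q : 'M[Zl]_b) (n : nat) (v : 'cV[Zl]_b) : nat :=
  least [set k | (0 < k)%N /\ eqmodmx (l ^ n)%:R (Q ^+ k *m v) v]%classic.

Definition kmin (Q : 'M[Zl]_b) (n : nat) : nat :=
  least [set k | exists2 v, primitive v & k = kord Q n v]%classic.
End Orders.

Definition algebraic_closure (k : fieldType) (K : closedFieldType)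
  (phi : {rmorphism k -> K}) := forall x : K, algebraicOver phi x.

Section Evaluation.
Variables (l : nat) (pl : prime l) (K : closedFieldType).
Local Notation Zl := (padic_int pl).
Variable phi : {rmorphism {fraction Zl} -> K}.

Definition padic_emb (a : Zl) : K := phi (tofrac a).

(* Z_l[z] *)
Definition adjoin_int (z : K) : set K :=
  [set x | exists p : {poly Zl}, x = (map_poly padic_emb p).[z]]%classic.

Variables (zeta : nat -> K) (b r : nat).

(* s is the sum of f(x_1, ..., x_b) for the l-adic topology of Z_l[z] *)
Definition mpseries_sum (z : K) (f : mpseries b Zl) (x : 'I_b -> K) (s : K) :=
  adjoin_int z s /\
  forall e : nat, exists N0 : nat, forall N, (N0 <= N)%N ->
    exists2 c, adjoin_int z c
      & s - mmap padic_emb x (mptrunc N f) = (l ^ e)%:R * c.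

Definition mpseries_eval (z : K) (f : mpseries b Zl) (x : 'I_b -> K) : K :=
  xget 0 [set s | mpseries_sum z f x s]%classic.

(* zeta_(l^n)^a, for a in Z_l *)
Definition zeta_pow (n : nat) (a : Zl) : K := zeta n ^+ residue a n.

Definition eval_at (F : 'M[mpseries b Zl]_r) (n : nat) (w : 'cV[Zl]_b) : 'M[K]_r :=
  \matrix_(i, j) mpseries_eval (zeta n) (F i j) (fun m => zeta_pow n (w m 0) - 1).

Definition Amx (F : 'M[mpseries b Zl]_r) (Q : 'M[Zl]_b) n (v : 'cV[Zl]_b) : 'M[K]_r :=
  \prod_(i <- rev (iota 0 (kord Q n v))) eval_at F n (Q ^+ i *m v).

Definition charp (F : 'M[mpseries b Zl]_r) (Q : 'M[Zl]_b) n (v : 'cV[Zl]_b) : {poly K} :=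
  \det (1%:M - 'X *: map_mx polyC (Amx F Q n v)).
End Evaluation.

(* Main.v *)
Require Import Defs.
From HB Require Import structures.
From mathcomp Require Import all_boot all_order all_algebra.
From mathcomp Require Import perm.
From mathcomp Require Import boolp classical_sets.
From mathcomp Require Import mpoly.
From mathcomp Require Import zify ring.

(** By the expansion det(1 - yA) = sum_i (-y)^i Tr(Lambda^i A) and the
    Cauchy-Binet formula, every coefficient of p_{n,v} is, up to sign, a sum
    over closed walks of length k_n; expanding the entries of F in monomials
    (which is legitimate modulo t_i^(l^(n+1)) = 1), it becomes a sum over
    cyclic words y of length k_n of w(y) zeta_{l^n}^(E(y)), with w(y) in Z_l,
    w invariant under rotation and E multiplied by q under rotation.  Write m
    for the valuation of q - 1, so that k_n = l^(n-m).  The rotation orbit of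
    a word of period l^d contributes w^(l^(n-m-d)), w being the weight of one
    period, times the trace of zeta_{l^(m+d)}^e down to Q_l(zeta_{l^m}); here
    the trace depends only on the period, not on n, because
    (q^(l^N) - 1)/(q^(l^d) - 1) is l^(N-d) times a unit congruent to 1 mod l^m.
    The trace is divisible by l^d, and w^(l^(a+1)) = w^(l^a) mod l^(a+1), so
    words of period dividing k_n contribute the same to both levels modulo
    k_(n+1); the orbits of the remaining words at level n+1 have size k_(n+1)
    and contribute 0. *)

Set Implicit Arguments.
Unset Strict Implicit.
Unset Printing Implicit Defensive.
Import GRing.Theory.

(** * Lifting the exponent and orbit sums *)

(** The q-analogue of [k], equal to (q^k - 1)/(q - 1) when q > 1; as a sum it stays within [nat]. *)
Definition geom (q k : nat) : nat := \sum_(i < k) q ^ i.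

Lemma geomS q k : geom q k.+1 = geom q k + q ^ k.
Proof. by rewrite /geom big_ord_recr. Qed.

Lemma geomD q a b : geom q (a + b) = geom q a + q ^ a * geom q b.
Proof.
rewrite /geom big_split_ord /= big_distrr /=; congr (_ + _).
by apply: eq_bigr => i _; rewrite expnD.
Qed.

Lemma geomM q a b : geom q (a * b) = geom q a * geom (q ^ a) b.
Proof.
elim: b => [|b IH]; first by rewrite muln0 /geom !big_ord0 muln0.
by rewrite mulnS addnC geomD IH geomS mulnDr expnM [geom q a * (_ ^ _)]mulnC.
Qed.

Lemma geom_mod d q k : q = 1 %[mod d] -> geom q k = k %[mod d].
Proof.
move=> q1; elim: k => [|k IH]; first by rewrite /geom big_ord0.
by rewrite geomS -modnDm IH -modnXm q1 modnXm exp1n modnDm addn1.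
Qed.

Section Lifting.
Variables (l : nat) (pl : prime l).
Implicit Types q k m d : nat.

Lemma expn_mod1 d q k : q = 1 %[mod d] -> q ^ k = 1 %[mod d].
Proof. by move=> q1; rewrite -modnXm q1 modnXm exp1n. Qed.

(** Write q = 1 + A with l^m dividing A. Modulo l^(m+1) the powers of 1 + A are linear in A because
    A^2 vanishes, and the linear terms sum to A l(l-1)/2, which vanishes because l is odd. *)
Lemma geom_prime (l_odd : odd l) m q : 0 < m -> q = 1 %[mod l ^ m] ->
  geom q l = l %[mod l ^ m.+1].
Proof.
move=> m0 q1.
have [q0 | q0] := posnP q.
  have l1 := prime_gt1 pl.
  move: q1; rewrite q0 mod0n modn_small; last by rewrite -(exp1n m) ltn_exp2r.
  by [].
have /dvdnP[y qy] : l ^ m %| q - 1 by rewrite -eqn_mod_dvd //; apply/eqP.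
have {q1 qy}-> : q = 1 + y * l ^ m by lia.
set A := y * l ^ m.
have dA : l ^ m.+1 %| A * A.
  rewrite /A mulnACA dvdn_mull // -expnD dvdn_exp2l //; lia.
have pA i : (1 + A) ^ i = 1 + i * A %[mod l ^ m.+1].
  elim: i => [|i IH]; first by rewrite mul0n.
  rewrite expnSr -modnMml IH modnMml.
  have -> : (1 + i * A) * (1 + A) = 1 + i.+1 * A + i * (A * A) by lia.
  by rewrite -modnDmr (eqP (dvdn_mull i dA)) addn0.
have gA k : geom (1 + A) k = \sum_(i < k) (1 + i * A) %[mod l ^ m.+1].
  rewrite /geom; elim: k => [|k IH]; first by rewrite !big_ord0.
  by rewrite !big_ord_recr /= -modnDm IH pA modnDm.
rewrite {}gA.
rewrite big_split /= sum1_card card_ord -big_distrl /= -(big_mkord xpredT id).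
rewrite bin2_sum bin2.
suff /eqP H : l ^ m.+1 %| (l * l.-1)./2 * A by rewrite -modnDmr H addn0.
have -> : (l * l.-1)./2 = l * l.-1./2.
  by rewrite -[in LHS](odd_double_half l.-1); have := prime_gt0 pl; lia.
by rewrite /A expnS -mulnA dvdn_mul // mulnA dvdn_mull.
Qed.

(** Induction along [geomM]: each step adds a factor [geom (q ^ l ^ a) l], which by [geom_prime] is
    l modulo l^(m+1); dividing by l leaves a cofactor known to be 1 modulo l^m. *)
Lemma geom_pexp (l_odd : odd l) m a q : 0 < m -> q = 1 %[mod l ^ m] ->
  exists2 e, geom q (l ^ a) = l ^ a * e & e = 1 %[mod l ^ m].
Proof.
move=> m0 q1; elim: a => [|a [e ge e1]].
  by exists 1; rewrite // expn0 /geom big_ord1.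
have g := geom_prime l_odd m0 (expn_mod1 (l ^ a) q1).
have l0 := prime_gt0 pl.
have /dvdnP[e' ge'] : l %| geom (q ^ l ^ a) l.
  have: l %| l ^ m.+1 by rewrite expnS dvdn_mulr.
  move=> /(modn_dvdm (geom (q ^ l ^ a) l)); rewrite g modn_dvdm ?expnS ?dvdn_mulr //.
  by rewrite modnn => /esym/eqP.
exists (e * e').
  by rewrite [l ^ a.+1]expnSr geomM ge ge'; lia.
rewrite -modnMm e1.
have -> : e' = 1 %[mod l ^ m].
  apply/eqP; rewrite -(eqn_pmul2l l0) !muln_modr -expnS mulnC -ge' muln1.
  exact/eqP.
by rewrite modnMm.
Qed.

Lemma mod1_coprime m e : 0 < m -> e = 1 %[mod l ^ m] -> coprime l e.
Proof.
move=> m0 e1; rewrite prime_coprime //; apply/negP => le.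
have: l %| l ^ m by rewrite dvdn_exp.
move=> /(modn_dvdm e); rewrite e1 modn_dvdm ?dvdn_exp // (eqP le).
by rewrite modn_small ?prime_gt1.
Qed.

Lemma mod1_gt0 m e : 0 < m -> e = 1 %[mod l ^ m] -> 0 < e.
Proof.
move=> m0 /(mod1_coprime m0); case: e => //.
by rewrite /coprime gcdn0 => /eqP l1; move: pl; rewrite l1.
Qed.

(** Split k into its l-part and a cofactor k' prime to l: [geom_pexp] gives the valuation of the
    first factor, and the second is congruent to k' modulo l. *)
Lemma logn_geom (l_odd : odd l) q k : q = 1 %[mod l] -> 0 < k ->
  logn l (geom q k) = logn l k.
Proof.
move=> q1 k0; have [k' ck' kE] := pfactor_coprime pl k0.
have q1' : q = 1 %[mod l ^ 1] by rewrite expn1.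
have [e ge e1] := geom_pexp l_odd (logn l k) (isT : 0 < 1) q1'.
rewrite [in LHS]kE mulnC geomM ge -mulnA.
have cx : coprime l (e * geom (q ^ l ^ logn l k) k').
  rewrite coprimeMr (mod1_coprime _ e1) //=.
  rewrite prime_coprime // /dvdn geom_mod; last exact: expn_mod1.
  by rewrite -/(dvdn _ _) -prime_coprime.
have x0 : 0 < e * geom (q ^ l ^ logn l k) k'.
  by rewrite lt0n; apply: contraL cx => /eqP->; rewrite /coprime gcdn0 gtn_eqF ?prime_gt1.
by rewrite lognM ?x0 ?expn_gt0 ?(prime_gt0 pl) // pfactorK // (logn_coprime cx) addn0.
Qed.

Lemma dvdn_expB1 (l_odd : odd l) q k N : q = 1 %[mod l] -> 1 < q -> 0 < k ->
  (l ^ N %| q ^ k - 1) = (N <= logn l (q - 1) + logn l k).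
Proof.
move=> q1 qgt1 k0.
have -> : q ^ k - 1 = (q - 1) * geom q k by rewrite subn1 predn_exp subn1.
have g0 : 0 < geom q k.
  by case: k k0 => // k _; rewrite geomS addn_gt0 expn_gt0 (ltnW qgt1) orbT.
by rewrite pfactor_dvdn // ?muln_gt0 ?g0 ?subn_gt0 ?qgt1 // lognM ?subn_gt0 // logn_geom.
Qed.

(** The unit e cancels, and by lifting the exponent q has order exactly l^d modulo l^(m+d). *)
Lemma powers_inj (l_odd : odd l) m q d e u u' : 0 < m -> 1 < q ->
  logn l (q - 1) = m -> coprime l e -> u < l ^ d -> u' < l ^ d ->
  q ^ u * e = q ^ u' * e %[mod l ^ (m + d)] -> u = u'.
Proof.
move=> m0 q1 qm ce; wlog: u u' / u <= u'.
  move=> H hu hu' E; case/orP: (leq_total u u') => uu'; first exact: H.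
  by apply/esym; apply: H.
move=> uu' hu hu' /esym/eqP; rewrite eqn_mod_dvd; last first.
  by rewrite leq_mul2r leq_exp2l ?uu' ?orbT.
have qm1 : q = 1 %[mod l ^ m].
  by apply/eqP; rewrite eqn_mod_dvd ?(ltnW q1) // pfactor_dvdn ?qm // subn_gt0.
have ql : q = 1 %[mod l].
  have lm : l %| l ^ m by rewrite dvdn_exp.
  by rewrite -(modn_dvdm _ lm) qm1 modn_dvdm.
rewrite -mulnBl Gauss_dvdl ?coprimeXl //.
have -> : q ^ u' - q ^ u = q ^ u * (q ^ (u' - u) - 1).
  by rewrite mulnBr muln1 -expnD subnKC.
rewrite Gauss_dvdr; last by rewrite coprimeXl // coprimeXr // (mod1_coprime m0).
have [E|d0] := posnP (u' - u).
  by move=> _; apply/eqP; rewrite eqn_leq uu' -subn_eq0 E.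
rewrite dvdn_expB1 // qm leq_add2l -pfactor_dvdn // => /(dvdn_leq d0).
by rewrite leqNgt (leq_ltn_trans (leq_subr _ _)).
Qed.

End Lifting.

Section OrbitSums.
Variables (T : finType) (f : T -> T) (f_inj : injective f).

Lemma order_dvd_iter x k : iter k f x = x -> order f x %| k.
Proof.
move=> kx; have o0 := order_gt0 f x.
have E : iter (k %% order f x) f x = x.
  rewrite -[RHS]kx [in RHS](divn_eq k (order f x)) addnC iterD.
  by congr (iter _ f _); elim: (k %/ _) => //= j IH; rewrite mulSn iterD -IH iter_order.
have := findex_iter (ltn_pmod k o0); rewrite E findex0 => /esym/eqP.
by [].
Qed.

(** Since [P] is invariant under [f], its support is a disjoint union of orbits, and an additively
    closed property can be tested on each of them. *)
Lemma big_orbit (V : nmodType) (J : V -> Prop) (P : pred T) (g : T -> V) :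
  J 0%R -> (forall a b, J a -> J b -> J (a + b)%R) ->
  (forall x, P (f x) = P x) ->
  (forall x, P x -> J (\sum_(u < order f x) g (iter u f x))%R) ->
  J (\sum_(x | P x) g x)%R.
Proof.
move=> J0 JD fP Jg; have Pit u x : P (iter u f x) = P x.
  by elim: u => //= u <-; rewrite fP.
rewrite (partition_big (froot f) P) /=; last first.
  by move=> x Px; rewrite -(iter_findex (connect_root (frel f) x)) Pit.
elim/big_ind: _ => // r Pr.
(* The sum is grouped by [froot]; an index that is not its own root has an empty fibre. *)
have [rr|rr] := eqVneq (froot f r) r; last first.
  rewrite big_pred0 // => x; apply/andP => -[_ /eqP xr].
  by case/eqP: rr; rewrite -xr root_root //; apply: fconnect_sym.
suff -> : (\sum_(x | P x && (froot f x == r)) g x = \sum_(u < order f r) g (iter u f r))%R.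
  exact: Jg.
transitivity (\sum_(x <- orbit f r) g x)%R; last first.
  rewrite (big_nth r) size_orbit big_mkord; apply: eq_bigr => u _.
  by rewrite nth_traject.
rewrite -big_filter; apply: perm_big; apply: uniq_perm.
- by rewrite filter_uniq // index_enum_uniq.
- exact: orbit_uniq.
move=> x; rewrite mem_filter mem_index_enum andbT -fconnect_orbit.
rewrite -{1}rr root_connect; last exact: fconnect_sym.
rewrite fconnect_sym //; case C: (fconnect f r x); rewrite ?andbF // andbT.
by rewrite -(iter_findex C) Pit.
Qed.
End OrbitSums.

Local Open Scope ring_scope.

(** * Arithmetic of the l-adic integers *)

Section EqmodTheory.
Variables (R : comPzRingType) (a : R).
Implicit Types x y z : R.

Lemma eqmod_refl x : eqmod a x x.
Proof. by exists 0; rewrite subrr mulr0. Qed.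

Lemma eqmod_sym x y : eqmod a x y -> eqmod a y x.
Proof. by case=> c E; exists (- c); rewrite mulrN -E opprB. Qed.

Lemma eqmod_trans y x z : eqmod a x y -> eqmod a y z -> eqmod a x z.
Proof. by move=> [c E] [d H]; exists (c + d); rewrite mulrDr -E -H addrA subrK. Qed.

Lemma eqmodD x y x' y' : eqmod a x y -> eqmod a x' y' -> eqmod a (x + x') (y + y').
Proof. by move=> [c E] [d H]; exists (c + d); rewrite mulrDr -E -H opprD addrACA. Qed.

Lemma eqmodM x y x' y' : eqmod a x y -> eqmod a x' y' -> eqmod a (x * x') (y * y').
Proof.
move=> [c E] [d H]; exists (c * x' + y * d).
by rewrite mulrDr mulrA -E mulrCA -H; ring.
Qed.

Lemma eqmodX x y k : eqmod a x y -> eqmod a (x ^+ k) (y ^+ k).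
Proof.
move=> E; elim: k => [|k IH]; first by rewrite !expr0; apply: eqmod_refl.
by rewrite !exprS; apply: eqmodM.
Qed.
End EqmodTheory.

Section Frobenius.
Variables (R : comNzRingType) (l : nat) (pl : prime l).

Lemma eqmod_frob (x y : R) : eqmod l%:R ((x + y) ^+ l) (x ^+ l + y ^+ l).
Proof.
case: l pl => // k pk.
exists (\sum_(i < k) (x ^+ (k.+1 - i.+1) * y ^+ i.+1) *+ ('C(k.+1, i.+1) %/ k.+1)).
rewrite exprDn big_ord_recl big_ord_recr /= !subn0 !expr0 bin0.
rewrite /bump /= add1n subnn binn mulr1 expr0 mul1r !mulr1n.
rewrite addrCA addrK mulr_sumr.
apply: eq_bigr => i _; rewrite /bump /= add1n mulr_natl -mulrnA divnK //.
by apply: prime_dvd_bin => //=; rewrite ltnS ltn_ord.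
Qed.

Lemma eqmod_frobX (x y : R) N :
  eqmod l%:R ((x + y) ^+ (l ^ N)) (x ^+ (l ^ N) + y ^+ (l ^ N)).
Proof.
elim: N => [|N IH]; first by rewrite !expr1; apply: eqmod_refl.
rewrite expnSr !exprM; apply: eqmod_trans (eqmod_frob _ _).
exact: eqmodX.
Qed.

(** The cofactor of x - y in x^l - y^l is a sum of l terms, all congruent to y^(l-1) modulo l, hence
    it is divisible by l. *)
Lemma eqmod_lift (x y : R) a : (0 < a)%N ->
  eqmod (l ^ a)%:R x y -> eqmod (l ^ a.+1)%:R (x ^+ l) (y ^+ l).
Proof.
move=> a0 [c E].
have [d H] : eqmod l%:R (\sum_(i < l) x ^+ (l.-1 - i) * y ^+ i) 0.
  have xy : eqmod l%:R x y.
    by exists ((l ^ a.-1)%:R * c); rewrite E mulrA -natrM -expnS prednK.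
  apply: (@eqmod_trans _ _ (\sum_(i < l) y ^+ l.-1)); last first.
    by exists (y ^+ l.-1); rewrite subr0 sumr_const card_ord mulr_natl.
  elim/big_ind2: _ => [|*|i _]; [exact: eqmod_refl|exact: eqmodD|].
  have {2}-> : l.-1 = (l.-1 - i + i)%N by have := ltn_ord i; lia.
  by rewrite exprD; apply: eqmodM; [apply: eqmodX|apply: eqmod_refl].
exists (c * d); rewrite subrXX E -[\sum_(i < l) _]subr0 H expnSr natrM; ring.
Qed.
End Frobenius.

Section Padic.
Variables (l : nat) (pl : prime l).
Local Notation Zl := (padic_int pl).
Implicit Types x y z : Zl.

Lemma residue_nat k n : residue (k%:R : Zl) n = (k %% l ^ n)%N.
Proof.
elim: k => [|k IH]; first by rewrite /= mod0n.
by rewrite -addn1 natrD /= IH modnDm.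
Qed.

Lemma residue0 n : residue (0 : Zl) n = 0%N.
Proof. by rewrite /= mod0n. Qed.

(** The quotient is built level by level: its residue at level j comes from dividing the residue of
    z at level n + j by l^n. *)
Lemma residue0_dvd z n : residue z n = 0%N -> exists c, z = (l ^ n)%:R * c.
Proof.
move=> zn0; have l0 k := pl_gt0 pl k.
have dz j : (l ^ n %| residue z (n + j))%N by rewrite /dvdn residueD zn0.
have fP j : residue z (n + j.+1) %/ l ^ n = residue z (n + j) %/ l ^ n %[mod l ^ j].
  rewrite addnS; set A := residue z (n + j).+1.
  have -> : A = (A %/ l ^ (n + j) * l ^ j * l ^ n + residue z (n + j))%N.
    by rewrite {1}(divn_eq A (l ^ (n + j))) residueP expnD -mulnA [(l ^ n * _)%N]mulnC.
  by rewrite divnMDl // modnMDl.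
exists (mk_padic pl fP); apply/padic_eqP => j /=.
rewrite -/((l ^ n)%:R : Zl) residue_nat modnMm mulnC divnK // -(residueD z j n).
by rewrite addnC.
Qed.

Lemma eqmod_residue x y n : eqmod (l ^ n)%:R x y <-> residue x n = residue y n.
Proof.
split=> [[c E]|E].
  have -> : x = y + (l ^ n)%:R * c by rewrite -E addrC subrK.
  rewrite /= -/((l ^ n)%:R : Zl) residue_nat modnn mul0n mod0n addn0.
  by rewrite residue_mod.
case: (@residue0_dvd (x - y) n) => [|c]; last by exists c.
by rewrite /= E modnDmr subnKC ?residue_le // modnn.
Qed.

Lemma residueM x y n : residue (x * y) n = ((residue x n * residue y n) %% l ^ n)%N.
Proof. by []. Qed.

Lemma residueX x k n : residue (x ^+ k) n = (residue x n ^ k %% l ^ n)%N.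
Proof.
elim: k => [|k IH]; first by rewrite expr0 (residue_nat 1).
by rewrite exprS residueM IH modnMmr expnS.
Qed.

Lemma eqmod_residue1 x y : eqmod l%:R x y <-> residue x 1 = residue y 1.
Proof. exact: (eqmod_residue x y 1). Qed.

Lemma padic_prime x y : eqmod l%:R (x * y) 0 -> eqmod l%:R x 0 \/ eqmod l%:R y 0.
Proof.
rewrite !eqmod_residue1 residueM residue0 => /eqP.
rewrite -/(dvdn _ _) expn1 Euclid_dvdM // => /orP[] h; [left|right];
by rewrite -(residue_mod _ 1) expn1; apply/eqP.
Qed.

Lemma padic_fermat x a : eqmod (l ^ a.+1)%:R (x ^+ (l ^ a.+1)) (x ^+ (l ^ a)).
Proof.
elim: a => [|a IH]; last first.
  by have := eqmod_lift pl (isT : (0 < a.+1)%N) IH; rewrite -!exprM -!expnSr.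
apply/eqmod_residue; rewrite expr1 residueX expn1 fermat_little //.
by rewrite -{2}(expn1 l) residue_mod.
Qed.

(** Completeness of Z_l, with [B] a modulus of convergence: the limit modulo l^e is read off at
    index [B e]. *)
Lemma padic_limit (u : nat -> Zl) (B : nat -> nat) :
  (forall e, B e <= B e.+1)%N ->
  (forall e N M, (B e <= N)%N -> (B e <= M)%N -> eqmod (l ^ e)%:R (u N) (u M)) ->
  exists a, forall e N, (B e <= N)%N -> eqmod (l ^ e)%:R a (u N).
Proof.
move=> Bm uC.
have fP e : (residue (u (B e.+1)) e.+1 %% l ^ e = residue (u (B e)) e)%N.
  by rewrite residueP; apply/eqmod_residue; apply: uC.
exists (PadicInt pl fP) => e N BN; apply/eqmod_residue => /=.
by apply/eqmod_residue; apply: uC.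
Qed.

Lemma padic_natr_neq0 n : (l ^ n)%:R != 0 :> Zl.
Proof.
apply/eqP => /(congr1 (fun x => residue x n.+1)); rewrite residue_nat residue0 => /eqP.
rewrite -/(dvdn _ _) => /(dvdn_leq (pl_gt0 pl n)).
by rewrite leqNgt ltn_exp2l ?ltnSn ?prime_gt1.
Qed.

End Padic.

(** * Integrality and evaluation of power series *)

Section Embedding.
Variables (l : nat) (pl : prime l) (K : closedFieldType).
Local Notation Zl := (padic_int pl).
Variable phi : {rmorphism {fraction Zl} -> K}.
Local Notation emb := (padic_emb phi).

HB.instance Definition _ := GRing.RMorphism.copy emb (phi \o @tofrac Zl).

Lemma emb_inj : injective emb.
Proof. by move=> x y /fmorph_inj /eqP; rewrite tofrac_eq => /eqP. Qed.

Lemma natr_prime_neq0 n : (l ^ n)%:R != 0 :> K.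
Proof.
by rewrite -(rmorph_nat emb) -(rmorph0 emb) (inj_eq emb_inj) padic_natr_neq0.
Qed.

Section Adjoin.
Variable z : K.
Local Notation Zlz := (adjoin_int phi z).

Lemma adjoin_emb a : Zlz (emb a).
Proof. by exists a%:P; rewrite map_polyC hornerC. Qed.

Lemma adjoin0 : Zlz 0. Proof. by rewrite -(rmorph0 emb); apply: adjoin_emb. Qed.
Lemma adjoin1 : Zlz 1. Proof. by rewrite -(rmorph1 emb); apply: adjoin_emb. Qed.

Lemma adjoinD x y : Zlz x -> Zlz y -> Zlz (x + y).
Proof. by move=> [p ->] [q ->]; exists (p + q); rewrite rmorphD hornerD. Qed.

Lemma adjoinM x y : Zlz x -> Zlz y -> Zlz (x * y).
Proof. by move=> [p ->] [q ->]; exists (p * q); rewrite rmorphM hornerM. Qed.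

Lemma adjoin_gen : Zlz z.
Proof. by exists 'X; rewrite map_polyX hornerX. Qed.

Lemma adjoinX x k : Zlz x -> Zlz (x ^+ k).
Proof. by move=> xz; elim: k => [|k IH]; rewrite ?exprS; [apply: adjoin1|apply: adjoinM]. Qed.

Lemma adjoin_sum (I : Type) (r : seq I) (P : pred I) (F : I -> K) :
  (forall i, P i -> Zlz (F i)) -> Zlz (\sum_(i <- r | P i) F i).
Proof. by move=> ZF; elim/big_ind: _ => //; [apply: adjoin0|apply: adjoinD]. Qed.

Lemma adjoin_prod (I : Type) (r : seq I) (P : pred I) (F : I -> K) :
  (forall i, P i -> Zlz (F i)) -> Zlz (\prod_(i <- r | P i) F i).
Proof. by move=> ZF; elim/big_ind: _ => //; [apply: adjoin1|apply: adjoinM]. Qed.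

Lemma integral_adjoin x : integralOver emb z -> Zlz x -> integralOver emb x.
Proof.
move=> zi [p ->]; apply: integral_horner => //; apply/integral_poly => i.
by rewrite coef_map; apply: integral_id.
Qed.
End Adjoin.

(* Z_l is integrally closed; only the part at l is needed *)
Lemma integral_dvd_prime (a : Zl) y :
  integralOver emb y -> emb a = l%:R * y -> exists c, a = l%:R * c.
Proof.
move=> [p pm /rootP py] ay.
have [d sp] : exists d, size p = d.+1.
  by exists (size p).-1; rewrite prednK // size_poly_gt0 monic_neq0.
have lp : p`_d = 1 by move: pm; rewrite monicE lead_coefE sp => /eqP.
(* Multiplying the monic equation of y by l^d gives a monic equation for a = l y with lower
   coefficients divisible by l; so l divides a^d, hence a. *)
have E : emb (a ^+ d + l%:R * \sum_(i < d) p`_i * l%:R ^+ (d - i.+1) * a ^+ i) = 0.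
  have -> : 0 = l%:R ^+ d * (map_poly emb p).[y] by rewrite py mulr0.
  rewrite (@horner_coef_wide _ d.+1); last by rewrite -sp size_poly.
  rewrite big_ord_recr /= coef_map /= lp rmorph1 mul1r mulrDr -exprMn -ay addrC.
  rewrite rmorphD rmorphXn /=; congr (_ + _).
  rewrite rmorphM /= mulr_sumr rmorph_sum rmorph_nat /= mulr_sumr; apply: eq_bigr => i _.
  rewrite !rmorphM /= !rmorphXn /= rmorph_nat ay coef_map /= exprMn.
  have -> : l%:R ^+ d = l%:R * l%:R ^+ (d - i.+1) * l%:R ^+ i :> K.
    by rewrite -exprS -exprD; congr (_ ^+ _); have := ltn_ord i; lia.
  ring.
have : eqmod l%:R (a ^+ d) 0.
  move/eqP: E; rewrite -(rmorph0 emb) (inj_eq emb_inj) addr_eq0 => /eqP->.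
  by rewrite -mulrN; eexists; rewrite subr0.
have ga : eqmod l%:R a 0 -> exists c, a = l%:R * c.
  by case=> c; rewrite subr0; exists c.
elim: (d) => [|k IH]; last first.
  by rewrite exprS => /padic_prime[].
rewrite expr0 => /eqmod_residue1; rewrite residue0 (residue_nat pl 1).
by rewrite expn1 modn_small // prime_gt1.
Qed.

Lemma integral_dvd (a : Zl) y e :
  integralOver emb y -> emb a = (l ^ e)%:R * y -> exists c, a = (l ^ e)%:R * c.
Proof.
elim: e a => [|e IH] a iy; first by exists a; rewrite expn0 mul1r.
rewrite expnS natrM -mulrA => ay.
have [|c ac] := @integral_dvd_prime a ((l ^ e)%:R * y) _ ay.
  by apply: integral_mul => //; apply: integral_nat.
have [|c' cE] := IH c iy; last by exists c'; rewrite ac cE natrM mulrA.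
apply: (mulfI (natr_prime_neq0 1)); rewrite expn1 -ay ac rmorphM rmorph_nat //.
Qed.

(** If x is nonzero, cancelling powers of X in a monic equation of x leaves one with nonzero
    constant term. That term is a multiple of x, so every l^e divides it, first among integral
    elements and then in Z_l by [integral_dvd]: a contradiction. *)
Lemma adjoin_separated z x : integralOver emb z -> adjoin_int phi z x ->
  (forall e, exists2 c, adjoin_int phi z c & x = (l ^ e)%:R * c) -> x = 0.
Proof.
move=> iz zx xe; apply/eqP; case: (eqVneq x 0) => // x0.
have [p pm px] := integral_adjoin iz zx.
have [m [q]] := multiplicity_XsubC p 0; rewrite (monic_neq0 pm) /= => q0 pE.
have qx : (map_poly emb q).[x] = 0.
  move: px; rewrite pE rmorphM rmorphXn rmorphB /= map_polyX map_polyC /= rmorph0 subr0.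
  rewrite rootM => /orP[/rootP //|]; rewrite /root hornerXn expf_eq0 (negPf x0) andbF //.
case/negP: q0; rewrite /root horner_coef0; apply/eqP/padic_eqP => e.
rewrite residue0.
have [q1 [c qE]] : exists q1 c, q = q1 * 'X + c%:P.
  by elim/poly_ind: (q) => [|q1 c _]; [exists 0, 0; rewrite mul0r addr0|exists q1, c].
have [c' zc' xE] := xe e.
have ec : emb q`_0 = (l ^ e)%:R * (- c' * (map_poly emb q1).[x]).
  move/eqP: qx; rewrite qE rmorphD rmorphM /= map_polyX map_polyC /= hornerD hornerMX hornerC.
  rewrite addrC addr_eq0 => /eqP.
  rewrite coefD coefMX eqxx add0r coefC eqxx => ->.
  by rewrite [X in - (_ * X)]xE; ring.
have [|c'' ->] := integral_dvd _ ec.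
  apply: (integral_adjoin iz); apply: adjoinM; last first.
    rewrite horner_coef; apply: adjoin_sum => i _; apply: adjoinM.
      by rewrite coef_map; apply: adjoin_emb.
    exact: adjoinX.
  by rewrite -mulN1r -(rmorph1 emb) -rmorphN; apply: adjoinM => //; apply: adjoin_emb.
by rewrite residueM residue_nat modnn mul0n mod0n.
Qed.

(** By separatedness a series has at most one sum, so the choice made by [xget] is determined. *)
Lemma mpseries_eval_sum z b (f : mpseries b Zl) x s : integralOver emb z ->
  mpseries_sum phi z f x s -> mpseries_eval phi z f x = s.
Proof.
move=> iz fs; rewrite /mpseries_eval; case: xgetP => [t _ /= ft|/(_ s)//].
have zN1 : adjoin_int phi z (-1 : K) by rewrite -(rmorph1 emb) -rmorphN; apply: adjoin_emb.
apply/eqP; rewrite -subr_eq0; apply/eqP; apply: (adjoin_separated iz).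
  by rewrite -mulN1r; apply: adjoinD; [case: ft|apply: adjoinM; [|case: fs]].
move=> e; have [_ /(_ e)[N1 H1]] := ft; have [_ /(_ e)[N2 H2]] := fs.
have [c1 zc1 E1] := H1 _ (leq_maxl N1 N2).
have [c2 zc2 E2] := H2 _ (leq_maxr N1 N2).
exists (c1 - c2); first by rewrite -mulN1r; apply: adjoinD => //; apply: adjoinM.
by rewrite mulrBr -E1 -E2 opprB addrA subrK.
Qed.

End Embedding.

Lemma big_bmultinom_le (R : nmodType) b (g : 'X_{1..b} -> R) M N : (M <= N)%N ->
  \sum_(m : 'X_{1..b < N}) g m
    = \sum_(m : 'X_{1..b < M}) g m + \sum_(m : 'X_{1..b < N} | (M <= mdeg m)%N) g m.
Proof.
move=> MN; rewrite (bigID (fun m : 'X_{1..b < N} => (mdeg m < M)%N)) /=.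
congr (_ + _); last by apply: eq_bigl => m; rewrite -leqNgt.
pose h (m : 'X_{1..b < M}) : 'X_{1..b < N} := BMultinom (leq_trans (bmdeg m) MN).
(* M = 0 is set apart because [insubd] below needs an inhabitant of ['X_{1..b < M}] as default. *)
have [M0 | M0] := posnP M.
  rewrite big_pred0 => [|m]; last by rewrite M0.
  by rewrite big1 // => -[m mM]; exfalso; move: mM; rewrite M0.
have zM : (mdeg (0%MM : 'X_{1..b}) < M)%N by rewrite mdeg0.
pose h' (m : 'X_{1..b < N}) : 'X_{1..b < M} := insubd (BMultinom zM) (bmnm m).
rewrite (reindex_onto h h') /=; last first.
  by move=> m mM; apply: val_inj; rewrite /= /h' val_insubd mM.
apply: eq_bigl => m; rewrite bmdeg /=; apply/eqP; apply: val_inj.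
by rewrite val_insubd /= bmdeg.
Qed.

(** * Power series at roots of unity as finite sums of monomials *)

Section Expansion.
Variables (l : nat) (pl : prime l) (l_odd : odd l) (K : closedFieldType).
Local Notation Zl := (padic_int pl).
Variable phi : {rmorphism {fraction Zl} -> K}.
Local Notation emb := (padic_emb phi).
Variable N : nat.
Local Notation D := (l ^ N)%N.

(** As l is odd, (X - 1)^D is X^D - 1 modulo l, so at a root of X^D = 1 each block of D factors x -
    1 yields a factor l. One p serves all such x. *)
Lemma subr1_expE m : exists p : {poly Zl}, forall x : K, x ^+ D = 1 ->
  (x - 1) ^+ m = (l ^ (m %/ D))%:R * (map_poly emb p).[x].
Proof.
have [G GE] := @eqmod_frobX {poly Zl} l pl 'X (-1) N.
exists (('X - 1) ^+ (m %% D) * G ^+ (m %/ D)) => x xD.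
have H : (x - 1) ^+ D = l%:R * (map_poly emb G).[x].
  move/(congr1 (fun p => (map_poly emb p).[x])): GE.
  rewrite rmorphB rmorphXn rmorphB rmorph1 rmorphD rmorphM rmorphXn rmorph_nat /=.
  rewrite map_polyX rmorphXn rmorphN rmorph1 !hornerE xD.
  by rewrite -signr_odd oddX l_odd orbT expr1 subrr subr0 -polyC_natr hornerC.
rewrite rmorphM !rmorphXn rmorphB /= map_polyX rmorph1 !hornerE.
rewrite {1}(divn_eq m D) exprD mulnC exprM H exprMn /=; ring.
Qed.

Lemma horner_fold (p : {poly Zl}) : exists d : 'I_D -> Zl,
  forall x : K, x ^+ D = 1 -> (map_poly emb p).[x] = \sum_a emb (d a) * x ^+ a.
Proof.
have D0 : (0 < D)%N := pl_gt0 pl N.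
exists (fun a : 'I_D => \sum_(j < size p | (j %% D == a)%N) p`_j) => x xD.
rewrite (@horner_coef_wide _ (size p)) ?size_poly //.
pose cl (j : 'I_(size p)) := Ordinal (ltn_pmod j D0).
rewrite (partition_big cl xpredT) //=; apply: eq_bigr => a _.
rewrite rmorph_sum mulr_suml /=; apply: eq_big => [j|j /eqP <-] //=.
by rewrite coef_map /= [X in _ * x ^+ X = _](divn_eq j D) exprD mulnC exprM xD expr1n mul1r.
Qed.

Lemma subr1_exp_expand : exists d : nat -> 'I_D -> Zl,
  (forall m a e, (e <= m %/ D)%N -> eqmod (l ^ e)%:R (d m a) 0) /\
  forall m (x : K), x ^+ D = 1 -> (x - 1) ^+ m = \sum_a emb (d m a) * x ^+ a.
Proof.
have /choice[d dP] : forall m, exists d : 'I_D -> Zl,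
    (forall a e, (e <= m %/ D)%N -> eqmod (l ^ e)%:R (d a) 0) /\
    forall x : K, x ^+ D = 1 -> (x - 1) ^+ m = \sum_a emb (d a) * x ^+ a.
  move=> m; have [p pE] := subr1_expE m; have [d dE] := horner_fold p.
  exists (fun a => (l ^ (m %/ D))%:R * d a); split=> [a e em|x xD].
    by exists ((l ^ (m %/ D - e))%:R * d a); rewrite subr0 mulrA -natrM -expnD subnKC.
  rewrite pE // dE // mulr_sumr; apply: eq_bigr => a _.
  by rewrite rmorphM rmorph_nat mulrA.
by exists d; split=> [m|m]; case: (dP m).
Qed.

Variables (b : nat) (b_gt0 : (0 < b)%N).

(** Each monomial in the T_i is rewritten in powers of the t_i with exponents below D, and the
    resulting coefficients converge in Z_l. The limits [a] depend on f alone, not on the point x, so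
    they can be shared by different levels. *)
Lemma mpseries_expand (f : mpseries b Zl) : exists a : {ffun 'I_b -> 'I_D} -> Zl,
  forall z (x : 'I_b -> K), integralOver emb z -> (forall i, x i ^+ D = 1) ->
    (forall i, adjoin_int phi z (x i)) ->
  mpseries_eval phi z f (fun i => x i - 1) = \sum_al emb (a al) * \prod_i x i ^+ al i.
Proof.
have D0 : (0 < D)%N := pl_gt0 pl N.
have [d [d_dvd dE]] := subr1_exp_expand.
pose dd (m : 'X_{1..b}) (al : {ffun 'I_b -> 'I_D}) := \prod_i d (m i) (al i).
(* Pigeonhole: a total degree of at least b D e forces some exponent to be at least D e, and that
   variable alone supplies l^e. *)
have dd_dvd m al e : (b * (D * e) <= mdeg m)%N -> eqmod (l ^ e)%:R (dd m al) 0.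
  move=> me; have [i mi] : exists i, (D * e <= m i)%N.
    apply: contrapT => /forallNP H; move: me; apply/negP; rewrite -ltnNge mdegE.
    case: e H => [|e] H; first by case: (H (Ordinal b_gt0)); rewrite muln0.
    have De : (0 < D * e.+1)%N by rewrite muln_gt0 D0.
    apply: (@leq_ltn_trans (\sum_(i < b) (D * e.+1).-1)).
      by apply: leq_sum => i _; have /negP := H i; rewrite -ltnNge; lia.
    by rewrite sum_nat_const card_ord ltn_pmul2l // prednK.
  rewrite /dd (bigD1 i) //= -(mul0r (\prod_(j | j != i) d (m j) (al j))).
  by apply: eqmodM; [apply: d_dvd; rewrite leq_divRL // mulnC|apply: eqmod_refl].
pose u al M : Zl := \sum_(m : 'X_{1..b < M}) mpcoef f m * dd m al.
have u_cauchy al e M M' : (b * (D * e) <= M)%N -> (b * (D * e) <= M')%N ->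
    eqmod (l ^ e)%:R (u al M) (u al M').
  have key P : (b * (D * e) <= P)%N -> eqmod (l ^ e)%:R (u al P) (u al (b * (D * e))%N).
    move=> eP; rewrite /u (big_bmultinom_le (fun m => mpcoef f m * dd m al) eP).
    rewrite -[X in eqmod _ _ X]addr0; apply: eqmodD; first exact: eqmod_refl.
    elim/big_ind: _ => [|x y hx hy|m hm]; first exact: eqmod_refl.
      by rewrite -(addr0 0); apply: eqmodD.
    by rewrite -(mulr0 (mpcoef f m)); apply: eqmodM; [apply: eqmod_refl|apply: dd_dvd].
  move=> hM hM'; apply: eqmod_trans (key _ hM) _; apply: eqmod_sym; exact: key.
have /choice[a aP] : forall al, exists a, forall e M, (b * (D * e) <= M)%N ->
    eqmod (l ^ e)%:R a (u al M).
  move=> al; apply: padic_limit => [e|e M M']; last exact: u_cauchy.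
  by rewrite !leq_mul2l leqnSn !orbT.
exists a => z x iz xD xz; apply: mpseries_eval_sum => //.
have zx al : adjoin_int phi z (\prod_i x i ^+ al i).
  by apply: adjoin_prod => i _; apply: adjoinX.
split=> [|e].
  by apply: adjoin_sum => al _; apply: adjoinM => //; apply: adjoin_emb.
exists (b * (D * e))%N => M hM.
have -> : mmap emb (fun i => x i - 1) (mptrunc M f) =
    \sum_al emb (u al M) * \prod_i x i ^+ al i.
  rewrite /mptrunc raddf_sum /=.
  under [RHS]eq_bigr do rewrite rmorph_sum mulr_suml /=.
  rewrite exchange_big /=; apply: eq_bigr => m _.
  rewrite mmapZ mmapX /mmap1.
  under [X in _ * X = _]eq_bigr do rewrite dE //.
  rewrite bigA_distr_bigA mulr_sumr; apply: eq_bigr => al _.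
  by rewrite big_split /= rmorphM rmorph_prod mulrA.
have /choice[c cE] : forall al, exists c, a al - u al M = (l ^ e)%:R * c.
  by move=> al; have := aP al e M hM.
exists (\sum_al emb (c al) * \prod_i x i ^+ al i).
  by apply: adjoin_sum => al _; apply: adjoinM => //; apply: adjoin_emb.
rewrite -sumrB mulr_sumr; apply: eq_bigr => al _.
by rewrite -mulrBl -rmorphB cE rmorphM rmorph_nat mulrA.
Qed.

End Expansion.

(** * Compound matrices *)

Lemma det_mxsub_perm (R : comNzRingType) n (s : 'S_n) (A : 'M[R]_n) :
  \det (mxsub s s A) = \det A.
Proof.
have -> : mxsub s s A = row_perm s (col_perm s A).
  by apply/matrixP => i j; rewrite !mxE.
rewrite row_permE col_permE !det_mulmx !det_perm odd_permV mulrCA -signr_addb.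
by rewrite addbb mulr1.
Qed.

Section CompoundMatrix.
Variables (R : comNzRingType) (r i : nat) (x0 : 'I_r).
Implicit Types (I J : {set 'I_r}) (A B : 'M[R]_r).

(** The default [x0] is reached only when I has fewer than i elements. *)
Definition set_enum I (k : 'I_i) : 'I_r := nth x0 (enum I) k.

Lemma set_enum_inj I : #|I| = i -> injective (set_enum I).
Proof.
move=> Ii j k /eqP; rewrite nth_uniq ?enum_uniq -?cardE ?Ii //.
by move=> /eqP/val_inj.
Qed.

Lemma mem_set_enum I k : #|I| = i -> set_enum I k \in I.
Proof. by move=> Ii; rewrite -mem_enum mem_nth // -cardE Ii. Qed.

Lemma set_enumP I x : #|I| = i -> x \in I -> exists k, set_enum I k = x.
Proof.
move=> Ii xI; have xi : (index x (enum I) < i)%N by rewrite -Ii cardE index_mem mem_enum.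
by exists (Ordinal xi); rewrite /set_enum nth_index // mem_enum.
Qed.

Lemma det_mulmx_ffun (A : 'M[R]_(i, r)) (B : 'M[R]_(r, i)) :
  \det (A *m B) =
    \sum_(h : {ffun 'I_i -> 'I_r}) (\prod_k A k (h k)) * \det (rowsub h B).
Proof.
rewrite {1}/determinant.
under eq_bigr => s _.
  under eq_bigr do rewrite mxE.
  rewrite bigA_distr_bigA mulr_sumr.
  over.
rewrite exchange_big /=; apply: eq_bigr => h _.
rewrite mulr_sumr; apply: eq_bigr => s _.
rewrite big_split /= mulrCA; congr (_ * (_ * _)).
by apply: eq_bigr => k _; rewrite mxE.
Qed.

Lemma big_inj_image I (G : {ffun 'I_i -> 'I_r} -> R) : #|I| = i ->
  \sum_(h : {ffun 'I_i -> 'I_r} | injectiveb h && ([set h k | k : 'I_i] == I)) G h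
    = \sum_(s : 'S_i) G [ffun k => set_enum I (s k)].
Proof.
move=> Ii; pose e (s : 'S_i) : {ffun 'I_i -> 'I_r} := [ffun k => set_enum I (s k)].
have e_inj : injective e.
  move=> s t /ffunP st; apply/permP => k; have := st k; rewrite !ffunE.
  exact: set_enum_inj.
(* An inverse of [e] on the injections with image I; the default permutation is never taken
   there. *)
pose e' (h : {ffun 'I_i -> 'I_r}) : 'S_i := odflt (perm_one _) [pick s | e s == h].
rewrite (reindex_onto e e') /=; last first.
  move=> h /andP[/injectiveP hi /eqP hI].
  rewrite /e'; case: pickP => [s /eqP //|none].
  have /fin_all_exists[s0 s0E] : forall k, exists k', set_enum I k' = h k.
    by move=> k; apply: set_enumP => //; rewrite -hI imset_f.
  have s0i : injective s0.
    by move=> j k jk; apply: hi; rewrite -!s0E jk.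
  have := none (perm s0i); rewrite (_ : e _ = h) ?eqxx //.
  by apply/ffunP => k; rewrite ffunE permE.
apply: eq_bigl => s; apply/andP; split; last first.
  by rewrite /e'; case: pickP => [t /eqP /e_inj ->|/(_ s)]; rewrite ?eqxx.
apply/andP; split.
  by apply/injectiveP => j k; rewrite !ffunE => /(set_enum_inj Ii)/perm_inj.
rewrite eqEcard card_imset; last by move=> j k; rewrite !ffunE => /(set_enum_inj Ii)/perm_inj.
rewrite card_ord Ii leqnn andbT; apply/fintype.subsetP => x /imsetP[k _ ->].
by rewrite ffunE mem_set_enum.
Qed.

(** Expand by multilinearity over maps h. A map that is not injective repeats a row of B; those with
    image I are permutations of [set_enum I], and their signs assemble the minor of A. *)
Lemma Cauchy_Binet (A : 'M[R]_(i, r)) (B : 'M[R]_(r, i)) :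
  \det (A *m B) = \sum_(I : {set 'I_r} | #|I| == i)
    \det (colsub (set_enum I) A) * \det (rowsub (set_enum I) B).
Proof.
rewrite det_mulmx_ffun (bigID (fun h : {ffun 'I_i -> 'I_r} => injectiveb h)) /= addrC big1 ?add0r; last first.
  move=> h /injectivePn[j [k jk hjk]].
  rewrite (determinant_alternate jk) ?mulr0 // => t.
  by rewrite !mxE hjk.
rewrite (partition_big (fun h : {ffun 'I_i -> 'I_r} => [set h k | k : 'I_i])
  (fun I => #|I| == i)) /=; last first.
  by move=> h /injectiveP hi; rewrite card_imset // card_ord.
apply: eq_bigr => I /eqP Ii; rewrite big_inj_image //.
rewrite {2}/determinant mulr_suml; apply: eq_bigr => s _.
have -> : rowsub [ffun k => set_enum I (s k)] B = row_perm s (rowsub (set_enum I) B).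
  by apply/matrixP => j k; rewrite !mxE ffunE.
rewrite row_permE det_mulmx det_perm mulrA; congr (_ * _).
rewrite mulrC; congr (_ * _); apply: eq_bigr => k _.
by rewrite mxE ffunE.
Qed.

(** The matrix of the i-th exterior power. The boolean factor kills rows indexed by sets of the
    wrong size, so all subsets can serve as indices and intermediate sets of the wrong size drop out
    of products. *)
Definition compound A I J : R :=
  (#|I| == i)%:R * \det (mxsub (set_enum I) (set_enum J) A).

Lemma compoundM A B I J :
  compound (A * B) I J = \sum_(L : {set 'I_r}) compound A I L * compound B L J.
Proof.
rewrite /compound.
have -> : mxsub (set_enum I) (set_enum J) (A * B) =
    rowsub (set_enum I) A *m colsub (set_enum J) B.
  by apply/matrixP => j k; rewrite !mxE; apply: eq_bigr => t _; rewrite !mxE.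
rewrite Cauchy_Binet mulr_sumr [RHS](bigID (fun L : {set 'I_r} => #|L| == i)) /=.
rewrite [X in _ + X]big1 ?addr0 => [|L /negPf->]; last by rewrite mul0r mulr0.
apply: eq_bigr => L ->; rewrite mul1r mulrA; congr (_ * _ * _); congr determinant;
by apply/matrixP => j k; rewrite !mxE.
Qed.

End CompoundMatrix.

Section PrincipalMinors.
Variable R : comNzRingType.

Definition row_mask n (J : {set 'I_n}) (A : 'M[R]_n) : 'M[R]_n :=
  \matrix_(k, j) if k \in J then A k j else (k == j)%:R.

(** Listing J first through g, then its complement, makes the masked matrix block upper triangular
    with an identity block at the lower right. *)
Lemma det_row_mask i m n (J : {set 'I_n}) (g : 'I_i -> 'I_n) (A : 'M[R]_n) :
  n = (i + m)%N -> #|J| = i -> injective g -> (forall k, g k \in J) ->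
  \det (row_mask J A) = \det (mxsub g g A).
Proof.
move=> nim Ji gi gJ; subst n.
have Jm : #|~: J| = m.
  by have := cardsC J; rewrite Ji card_ord => /addnI.
pose g2 (k : 'I_m) : 'I_(i + m) := enum_val (cast_ord (esym Jm) k).
have g2i : injective g2 by move=> j k /enum_val_inj/cast_ord_inj.
have g2J k : g2 k \in J = false.
  by have := enum_valP (cast_ord (esym Jm) k); rewrite inE => /negPf.
pose s0 (k : 'I_(i + m)) := match split k with inl a => g a | inr b => g2 b end.
have s0l a : s0 (lshift m a) = g a by rewrite /s0 (unsplitK (inl a)).
have s0r a : s0 (rshift i a) = g2 a by rewrite /s0 (unsplitK (inr a)).
have s0i : injective s0.
  move=> j k; rewrite -(splitK j) -(splitK k).
  case: (split j) => a; case: (split k) => b; rewrite /= ?s0l ?s0r.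
  - by move=> /gi->.
  - by move=> E; have := gJ a; rewrite E g2J.
  - by move=> E; have := gJ b; rewrite -E g2J.
  - by move=> /g2i->.
rewrite -(det_mxsub_perm (perm s0i)) -[mxsub _ _ _]submxK.
have -> : ulsubmx (mxsub (perm s0i) (perm s0i) (row_mask J A)) = mxsub g g A.
  by apply/matrixP => a b; rewrite !mxE !permE !s0l gJ.
have -> : dlsubmx (mxsub (perm s0i) (perm s0i) (row_mask J A)) = 0.
  apply/matrixP => a b; rewrite !mxE !permE s0l s0r g2J.
  by case: eqP => // E; have := gJ b; rewrite -E g2J.
have -> : drsubmx (mxsub (perm s0i) (perm s0i) (row_mask J A)) = 1%:M.
  by apply/matrixP => a b; rewrite !mxE !permE !s0r g2J (inj_eq g2i).
by rewrite det_ublock det1 mulr1.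
Qed.

(** In each row choose either the part -yA or the identity part; the choices with set J of rows of
    the first kind add up to (-y)^|J| times the principal minor at J. *)
Lemma coef_det_1sub n i (x0 : 'I_n) (A : 'M[R]_n) :
  (\det (1%:M - 'X *: map_mx polyC A))`_i =
    (-1) ^+ i * \sum_(I : {set 'I_n}) compound i x0 A I I.
Proof.
have -> : \det (1%:M - 'X *: map_mx polyC A) =
    \sum_(J : {set 'I_n}) (- 'X) ^+ #|J| * (\det (row_mask J A))%:P.
  under [RHS]eq_bigr do rewrite -det_map_mx /determinant mulr_sumr.
  rewrite /determinant exchange_big /=; apply: eq_bigr => s _.
  under eq_bigr do rewrite !mxE addrC.
  rewrite bigA_distr mulr_sumr; apply: eq_bigr => J _.
  rewrite [RHS]mulrCA; congr (_ * _).
  rewrite -prodr_const [X in _ = X * _]big_mkcond -big_split /=.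
  apply: eq_bigr => k _; rewrite !mxE; case: ifP => _; first by rewrite mulNr.
  by rewrite mul1r rmorph_nat.
rewrite coef_sum mulr_sumr; apply: eq_bigr => J _.
rewrite (exprNn 'X) coefMC -(rmorph_sign (@polyC R)) coefCM coefXn /compound eq_sym.
have [Ji|_] := eqVneq #|J| i; last by rewrite mulr0 mul0r mul0r mulr0.
rewrite mulr1 mul1r Ji; congr (_ * _).
have Jn : (i <= n)%N by rewrite -Ji -[X in (_ <= X)%N](card_ord n) max_card.
apply: (@det_row_mask i (n - i)) => //; first by rewrite subnKC.
  exact: set_enum_inj.
by move=> k; apply: mem_set_enum.
Qed.
End PrincipalMinors.

(** * Rotation orbits of cyclic words *)

Lemma periodM (T : Type) (f : nat -> T) p t j :
  (forall j, f (j + p)%N = f j) -> f (j + p * t)%N = f j.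
Proof. by move=> fp; elim: t => [|t IH]; rewrite ?muln0 ?addn0 // mulnSr addnA fp. Qed.

Section CyclicWords.
Variables (Y : finType) (k : nat) (k_gt0 : (0 < k)%N).
Implicit Types y : {ffun 'I_k -> Y}.

Definition cyc y (j : nat) : Y := y (Ordinal (ltn_pmod j k_gt0)).

Lemma cyc_mod y i j : i = j %[mod k] -> cyc y i = cyc y j.
Proof. by move=> ij; congr (y _); apply: val_inj. Qed.

Lemma cyc_ord y (j : 'I_k) : cyc y j = y j.
Proof. by congr (y _); apply: val_inj; rewrite /= modn_small. Qed.

Lemma cyc_inj y y' : cyc y =1 cyc y' -> y = y'.
Proof. by move=> E; apply/ffunP => j; rewrite -!cyc_ord E. Qed.

(** The index is j - 1 modulo k: words move to the right, so that rotation multiplies the phase by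
    q. *)
Definition rotw y : {ffun 'I_k -> Y} := [ffun j : 'I_k => cyc y (j + k.-1)].

Lemma cyc_rotw y j : cyc (rotw y) j.+1 = cyc y j.
Proof.
rewrite {1}/cyc ffunE; apply: cyc_mod => /=.
by rewrite modnDml addSnnS prednK // modnDr.
Qed.

Lemma cyc_iter_rotw u y j : cyc (iter u rotw y) (j + u) = cyc y j.
Proof.
by elim: u j => [|u IH] j; rewrite ?addn0 //= addnS cyc_rotw.
Qed.

Lemma rotw_inj : injective rotw.
Proof. by move=> y y' E; apply: cyc_inj => j; rewrite -cyc_rotw E cyc_rotw. Qed.

Lemma iter_rotw_period u y :
  iter u rotw y = y <-> forall j, cyc y (j + u) = cyc y j.
Proof.
split=> [E j|E]; first by rewrite -{1}E cyc_iter_rotw.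
apply: cyc_inj => j; rewrite -[RHS](periodM k.-1 j E) -[RHS](cyc_iter_rotw u).
by apply: cyc_mod; rewrite -addnA -mulnSr prednK // addnC modnMDl.
Qed.

End CyclicWords.

(** * Traces of roots of unity *)

Section RootsOfUnity.
Variables (l : nat) (pl : prime l) (K : closedFieldType) (zeta : nat -> K).
Hypothesis zeta_prim : forall n : nat, (l ^ n).-primitive_root (zeta n).
Hypothesis zeta_compat : forall n : nat, zeta n.+1 ^+ l = zeta n.

Lemma zeta_exp n a : zeta (n + a) ^+ (l ^ a) = zeta n.
Proof.
by elim: a => [|a IH]; rewrite ?addn0 ?expr1 // addnS expnS exprM zeta_compat.
Qed.

Lemma zeta_mod n i j : i = j %[mod l ^ n] -> zeta n ^+ i = zeta n ^+ j.
Proof.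
by move=> ij; rewrite -(prim_expr_mod (zeta_prim n) i) ij (prim_expr_mod (zeta_prim n)).
Qed.

Variable m : nat.

(* the trace of zeta_(m+d)^e down to the field generated by zeta_m *)
Definition zeta_trace d e := \sum_(i < l ^ d) zeta (m + d) ^+ ((1 + l ^ m * i) * e).

(** After factoring out zeta_(m+d)^e, the sum runs over the powers of x = zeta_d^e with x^(l^d) = 1;
    it is l^d or 0 according to whether x = 1, which [c] records. *)
Lemma zeta_trace_dvd d e : exists k, exists c : bool,
  zeta_trace d e = (l ^ d)%:R * (c%:R * zeta (m + d) ^+ k).
Proof.
set x := zeta d ^+ e.
have E : zeta_trace d e = zeta (m + d) ^+ e * \sum_(i < l ^ d) x ^+ i.
  rewrite mulr_sumr; apply: eq_bigr => i _.
  rewrite mulnDl mul1n exprD -mulnA exprM.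
  by rewrite [(m + d)%N in X in _ * X]addnC zeta_exp /x -exprM mulnC.
exists e; have [x1|x1] := eqVneq x 1.
  exists true; rewrite E x1 mul1r mulrC; congr (_ * _).
  by under eq_bigr do rewrite expr1n; rewrite sumr_const card_ord.
exists false; rewrite mul0r mulr0 E; suff -> : \sum_(i < l ^ d) x ^+ i = 0 by rewrite mulr0.
apply: (@mulfI _ (x - 1)); first by rewrite subr_eq0.
by rewrite -subrX1 -exprM mulnC exprM (prim_expr_order (zeta_prim d)) expr1n subrr mulr0.
Qed.

(* modulo l^(m+d), the powers of q run through the classes 1 + l^m i *)
Lemma zeta_trace_powers (l_odd : odd l) q d e eps : (0 < m)%N -> (1 < q)%N ->
  logn l (q - 1) = m -> eps = 1 %[mod l ^ m] ->
  \sum_(u < l ^ d) zeta (m + d) ^+ (q ^ u * eps * e) = zeta_trace d e.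
Proof.
move=> m0 q1 qm eps1; have ld0 := pl_gt0 pl d.
have qm1 : q = 1 %[mod l ^ m].
  by apply/eqP; rewrite eqn_mod_dvd ?(ltnW q1) // pfactor_dvdn ?qm // subn_gt0.
(* [h u] is the index i of the class 1 + l^m i containing q^u eps; [powers_inj] makes it a
   permutation of the indices. *)
pose h (u : 'I_(l ^ d)) := Ordinal (ltn_pmod ((q ^ u * eps - 1) %/ l ^ m) ld0).
have hE (u : 'I_(l ^ d)) : q ^ u * eps = 1 + l ^ m * h u %[mod l ^ (m + d)].
  have qe1 : q ^ u * eps = 1 %[mod l ^ m].
    by rewrite -modnMm (expn_mod1 _ qm1) eps1 modnMm.
  have qe0 := mod1_gt0 pl m0 qe1.
  have dZ : (l ^ m %| q ^ u * eps - 1)%N by rewrite -eqn_mod_dvd //; apply/eqP.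
  rewrite /= muln_modr -expnD modnDmr [(l ^ m * _)%N]mulnC (divnK dZ).
  by rewrite subnKC.
have h_inj : injective h.
  move=> u u' huu'; apply: val_inj.
  have ce := mod1_coprime pl m0 eps1.
  apply: (powers_inj pl l_odd m0 q1 qm ce (ltn_ord u) (ltn_ord u')).
  by have := hE u; rewrite huu' -hE.
rewrite /zeta_trace [RHS](reindex_inj h_inj); apply: eq_bigr => u _.
by apply: zeta_mod; rewrite -modnMml hE modnMml.
Qed.

End RootsOfUnity.

(** * Cyclic sums at consecutive levels *)

Section CyclicSums.
Variables (l : nat) (pl : prime l) (l_odd : odd l) (K : closedFieldType).
Local Notation Zl := (padic_int pl).
Variable phi : {rmorphism {fraction Zl} -> K}.
Local Notation emb := (padic_emb phi).
Variable zeta : nat -> K.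
Hypothesis zeta_prim : forall n : nat, (l ^ n).-primitive_root (zeta n).
Hypothesis zeta_compat : forall n : nat, zeta n.+1 ^+ l = zeta n.
Variables (q m : nat).
Hypotheses (m_gt0 : (0 < m)%N) (q_gt1 : (1 < q)%N) (qm : logn l (q - 1) = m).
Variables (Y : finType) (c : Y -> Y -> Zl) (e : Y -> Y -> nat).
Implicit Types f : nat -> Y.

Definition weight k f : Zl := \prod_(j < k) c (f j) (f j.+1).
(** The factor q^j reflects that the j-th matrix in A_n(v) is evaluated at q^j v. *)
Definition phase k f : nat := (\sum_(j < k) q ^ j * e (f j) (f j.+1))%N.

Lemma weight_period p t f : (forall j, f (j + p)%N = f j) ->
  weight (p * t) f = weight p f ^+ t.
Proof.
move=> fp; elim: t => [|t IH]; first by rewrite muln0 /weight big_ord0.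
rewrite mulnSr exprSr -IH /weight big_split_ord /=; congr (_ * _).
apply: eq_bigr => j _; rewrite addnC -[in X in c _ X]addSn.
by rewrite !(periodM _ _ fp).
Qed.

Lemma phase_period p t f : (forall j, f (j + p)%N = f j) ->
  phase (p * t) f = (geom (q ^ p) t * phase p f)%N.
Proof.
move=> fp; elim: t => [|t IH]; first by rewrite muln0 /phase /geom !big_ord0.
rewrite mulnSr geomS mulnDl -IH {1}/phase big_split_ord /=; congr (_ + _)%N.
rewrite big_distrr /=; apply: eq_bigr => j _; rewrite expnD expnM.
by rewrite [(p * t + j)%N]addnC -addSn !(periodM _ _ fp) mulnA.
Qed.

Lemma weight_shift k f f' : (0 < k)%N -> (forall j, f' j.+1 = f j) ->
  (forall j, f' (j + k)%N = f' j) -> weight k f' = weight k f.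
Proof.
case: k => // k _ ff' fk; rewrite /weight big_ord_recl big_ord_recr /= mulrC.
congr (_ * _); first by apply: eq_bigr => j _; rewrite /bump /= !add1n -!ff'.
by rewrite -!ff' -[k.+1]add0n -addSn !fk.
Qed.

Lemma phase_shift k f f' M : (0 < k)%N -> (forall j, f' j.+1 = f j) ->
  (forall j, f' (j + k)%N = f' j) -> q ^ k = 1 %[mod M] ->
  phase k f' = q * phase k f %[mod M].
Proof.
case: k => // k _ ff' fk qk; pose B := e (f' 0%N) (f' 1%N).
have fk0 : f k = f' 0%N by rewrite -ff' -[k.+1]add0n fk.
have fk1 : f k.+1 = f' 1%N by rewrite -ff' -[k.+2]add1n fk.
(* The two phases differ only in the term B, with coefficient 1 on one side and a power of q
   congruent to 1 on the other; the additive form avoids truncated subtraction. *)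
have E : (phase k.+1 f' + q ^ k.+1 * B = q * phase k.+1 f + B)%N.
  rewrite /phase big_ord_recl big_ord_recr /= expn0 mul1n fk0 fk1 -/B mulnDr.
  rewrite [in RHS]mulnA -expnS -addnA addnC; congr (_ + _)%N; congr (_ + _)%N.
  rewrite big_distrr; apply: eq_bigr => j _.
  by rewrite /bump /= !add1n !ff' expnS mulnA.
apply/eqP; rewrite -(eqn_modDr B) -E -modnDmr -[X in _ == X]modnDmr.
by rewrite -(modnMml (q ^ k.+1)) qk modnMml mul1n.
Qed.

(* [f_ u] is the u-th rotate of the word [f_ 0] of period l^d *)
Lemma orbit_sum (f_ : nat -> nat -> Y) d a :
  (forall u j, f_ u.+1 j.+1 = f_ u j) -> (forall u j, f_ u (j + l ^ d)%N = f_ u j) ->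
  \sum_(u < l ^ d) emb (weight (l ^ (d + a)) (f_ u))
      * zeta (m + d + a) ^+ phase (l ^ (d + a)) (f_ u)
    = emb (weight (l ^ d) (f_ 0%N)) ^+ (l ^ a)
      * zeta_trace l zeta m d (phase (l ^ d) (f_ 0%N)).
Proof.
move=> fS fd; set k := (l ^ (d + a))%N.
have k0 : (0 < k)%N := pl_gt0 pl _.
have fk u j : f_ u (j + k)%N = f_ u j by rewrite /k expnD periodM.
have ql : q = 1 %[mod l].
  apply/eqP; rewrite eqn_mod_dvd ?(ltnW q_gt1) // -(expn1 l).
  by rewrite pfactor_dvdn ?qm // subn_gt0.
have qk : q ^ k = 1 %[mod l ^ (m + d + a)].
  apply/eqP; rewrite eqn_mod_dvd ?expn_gt0 ?(ltnW q_gt1) //.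
  by rewrite dvdn_expB1 // qm /k pfactorK // addnA.
have wE u : weight k (f_ u) = weight (l ^ d) (f_ 0%N) ^+ (l ^ a).
  elim: u => [|u IH]; first by rewrite /k expnD weight_period.
  by rewrite (weight_shift k0 (fS u)) // => j; apply: fk.
have pE u : phase k (f_ u) = q ^ u * phase k (f_ 0%N) %[mod l ^ (m + d + a)].
  elim: u => [|u IH]; first by rewrite mul1n.
  rewrite (phase_shift k0 (fS u) (fk u.+1) qk) -modnMmr IH modnMmr.
  by rewrite mulnA -expnS.
have qm1 : q = 1 %[mod l ^ m].
  by apply/eqP; rewrite eqn_mod_dvd ?(ltnW q_gt1) // pfactor_dvdn ?qm // subn_gt0.
(* The phase over l^a periods is l^a eps times that of one period: l^a turns zeta_(m+d+a) into
   zeta_(m+d), and eps only permutes the terms of the trace. *)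
have [eps gE eps1] := geom_pexp pl l_odd a m_gt0 (expn_mod1 (l ^ d) qm1).
rewrite -(zeta_trace_powers pl zeta_prim l_odd d _ m_gt0 q_gt1 qm eps1) mulr_sumr.
apply: eq_bigr => u _; rewrite wE rmorphXn; congr (_ * _).
rewrite (zeta_mod zeta_prim (pE u)) {1}/k expnD phase_period // gE.
rewrite -(zeta_exp zeta_compat (m + d) a) -exprM; congr (_ ^+ _); lia.
Qed.

Definition cyclic_sum N k (k0 : (0 < k)%N) : K :=
  \sum_(y : {ffun 'I_k -> Y})
     emb (weight k (cyc k0 y)) * zeta N ^+ phase k (cyc k0 y).


Lemma iter_rotw_dvd k (k0 : (0 < k)%N) (y : {ffun 'I_k -> Y}) t :
  (order (rotw k0) y %| t)%N -> iter t (rotw k0) y = y.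
Proof.
case/dvdnP=> u ->; apply/iter_rotw_period => j; rewrite mulnC.
apply: (@periodM _ (cyc k0 y)); apply/iter_rotw_period.
by apply: iter_order; apply: rotw_inj.
Qed.

Lemma order_rotw_dvd k (k0 : (0 < k)%N) (y : {ffun 'I_k -> Y}) :
  (order (rotw k0) y %| k)%N.
Proof.
apply: order_dvd_iter; first exact: rotw_inj.
by apply/iter_rotw_period => j; apply: cyc_mod; rewrite modnDr.
Qed.

(** The length [k] is independent of l^s so that one word can be read at both levels, with more or
    fewer repetitions of its period. *)
Lemma rotw_orbit_sum s (k0 : (0 < l ^ s)%N) (y : {ffun 'I_(l ^ s) -> Y}) d a k N :
  order (rotw k0) y = (l ^ d)%N -> k = (l ^ (d + a))%N -> N = (m + d + a)%N ->
  \sum_(u < order (rotw k0) y)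
     emb (weight k (cyc k0 (iter u (rotw k0) y)))
       * zeta N ^+ phase k (cyc k0 (iter u (rotw k0) y))
    = emb (weight (l ^ d) (cyc k0 y)) ^+ (l ^ a)
      * zeta_trace l zeta m d (phase (l ^ d) (cyc k0 y)).
Proof.
move=> od -> ->; rewrite od; apply: (orbit_sum (f_ := fun u => cyc k0 (iter u (rotw k0) y))).
  by move=> u j; apply: cyc_rotw.
move=> u; apply/iter_rotw_period; rewrite -od -iterD addnC iterD iter_order //.
exact: rotw_inj.
Qed.

Lemma cyclic_sum_congr s (k0 : (0 < l ^ s)%N) (k1 : (0 < l ^ s.+1)%N) :
  exists2 x, adjoin_int phi (zeta (m + s).+1) x &
    cyclic_sum (m + s).+1 k1 - cyclic_sum (m + s) k0 = (l ^ s.+1)%:R * x.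
Proof.
set n1 := (m + s).+1.
pose J z := exists2 x, adjoin_int phi (zeta n1) x & z = (l ^ s.+1)%:R * x.
have J0 : J 0 by exists 0; [exact: adjoin0|rewrite mulr0].
have JD x y : J x -> J y -> J (x + y).
  by move=> [a ha ->] [b hb ->]; exists (a + b); [exact: adjoinD|rewrite mulrDr].
have zetaJ d t k : (m + d <= n1)%N -> adjoin_int phi (zeta n1) t ->
    adjoin_int phi (zeta n1) (t * zeta (m + d) ^+ k).
  move=> dn ht; apply: adjoinM => //; apply: adjoinX.
  rewrite -(zeta_exp zeta_compat (m + d) (n1 - (m + d))) subnKC //.
  by apply: adjoinX; apply: adjoin_gen.
have boolJ (t : bool) : adjoin_int phi (zeta n1) t%:R.
  by case: t; [apply: adjoin1|apply: adjoin0].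
(* [lift] writes a word l times over; [restr] undoes it on the words satisfying [P]. *)
pose lift z : {ffun 'I_(l ^ s.+1) -> Y} := [ffun j : 'I_(l ^ s.+1) => cyc k0 z j].
have cyc_lift z : cyc k1 (lift z) = cyc k0 z.
  apply: funext => j; rewrite {1}/cyc ffunE; apply: cyc_mod => /=.
  by rewrite modn_dvdm // expnS dvdn_mull.
pose restr y : {ffun 'I_(l ^ s) -> Y} := [ffun j : 'I_(l ^ s) => cyc k1 y j].
pose P (y : {ffun 'I_(l ^ s.+1) -> Y}) := iter (l ^ s) (rotw k1) y == y.
rewrite -/(J _) /cyclic_sum (bigID P) /= addrAC.
apply: (JD).
  rewrite (reindex_onto lift restr) /=; last first.
    move=> y /eqP/iter_rotw_period yp; apply: (@cyc_inj _ _ k1) => j.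
    rewrite cyc_lift /cyc ffunE -/(cyc k1 y j).
    by rewrite [in RHS](divn_eq j (l ^ s)) addnC mulnC (periodM _ _ yp).
  rewrite (eq_bigl xpredT); last first.
    move=> z; apply/andP; split.
      by apply/eqP/iter_rotw_period => j; rewrite cyc_lift; apply: cyc_mod; rewrite modnDr.
    by apply/eqP/ffunP => j; rewrite ffunE cyc_lift cyc_ord.
  rewrite -sumrB; apply: (@big_orbit _ (rotw k0) (@rotw_inj _ _ k0) _ J) => //.
  move=> z _.
  have /(dvdn_pfactor _ _ pl)[d ds od] := order_rotw_dvd k0 z.
  rewrite sumrB; under eq_bigr do rewrite cyc_lift.
  rewrite (@rotw_orbit_sum s k0 z d (s - d).+1) //; first last.
  - by rewrite /n1; lia.
  - by congr (l ^ _)%N; lia.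
  rewrite (@rotw_orbit_sum s k0 z d (s - d)) //; first last.
  - by lia.
  - by congr (l ^ _)%N; lia.
  (* Both levels carry the same trace. The difference of powers of the weight gives l^(s-d+1) by
     [padic_fermat] and the trace gives l^d, in total l^(s+1). *)
  rewrite -mulrBl -!rmorphXn -rmorphB.
  have [x ->] := padic_fermat (weight (l ^ d) (cyc k0 z)) (s - d).
  have [k [t ->]] := zeta_trace_dvd zeta_prim zeta_compat m d (phase (l ^ d) (cyc k0 z)).
  exists (emb x * (t%:R * zeta (m + d) ^+ k)).
    by apply: adjoinM; [apply: adjoin_emb|apply: zetaJ => //; rewrite /n1; lia].
  have -> : s.+1 = ((s - d).+1 + d)%N by lia.
  by rewrite expnD natrM rmorphM rmorph_nat; ring.
(* The words outside [P] have orbits of full size l^(s+1), so the trace alone supplies the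
   modulus. *)
apply: (@big_orbit _ (rotw k1) (@rotw_inj _ _ k1) _ J) => //.
  by move=> y; rewrite /P -iterSr iterS (inj_eq (@rotw_inj _ _ k1)).
move=> y Py.
have /(dvdn_pfactor _ _ pl)[d ds od] := order_rotw_dvd k1 y.
have dE : d = s.+1.
  apply/eqP; rewrite eqn_leq ds ltnNge; apply: contraNN Py => dles.
  by apply/eqP; apply: iter_rotw_dvd; rewrite od dvdn_exp2l.
rewrite (@rotw_orbit_sum s.+1 k1 y d 0) //; first last.
- by rewrite /n1 dE; lia.
- by rewrite dE addn0.
have [k [t ->]] := zeta_trace_dvd zeta_prim zeta_compat m d (phase (l ^ d) (cyc k1 y)).
exists (emb (weight (l ^ d) (cyc k1 y)) * (t%:R * zeta (m + d) ^+ k)).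
  by apply: adjoinM; [apply: adjoin_emb|apply: zetaJ => //; rewrite /n1; lia].
by rewrite expn0 expr1 dE; ring.
Qed.

End CyclicSums.

(** * Closed walks *)

Section ClosedWalks.
Variables (R : comNzRingType) (X : finType) (M : nat -> X -> X -> R).

(** The entry at x, y of the matrix product M_(k-1) ... M_0. *)
Fixpoint walk k (x y : X) : R :=
  if k is k'.+1 then \sum_z M k' x z * walk k' z y else (x == y)%:R.

(** [w] lists the vertices at times 0 to k - 1 and [x] is the vertex at time k. *)
Definition wend k (w : {ffun 'I_k -> X}) (x : X) (j : nat) : X :=
  if insub j is Some i then w i else x.

Lemma wend_lt k (w : {ffun 'I_k -> X}) x (j : 'I_k) : wend w x j = w j.
Proof. by rewrite /wend valK. Qed.

Lemma wend_ge k (w : {ffun 'I_k -> X}) x j : (k <= j)%N -> wend w x j = x.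
Proof. by move=> kj; rewrite /wend insubN // -leqNgt. Qed.

Lemma big_ffun_rcons k (G : {ffun 'I_k.+1 -> X} -> R) :
  \sum_(w : {ffun 'I_k.+1 -> X}) G w =
  \sum_(z : X) \sum_(w : {ffun 'I_k -> X}) G [ffun j : 'I_k.+1 => wend w z j].
Proof.
rewrite pair_bigA /=.
pose h (p : X * {ffun 'I_k -> X}) : {ffun 'I_k.+1 -> X} :=
  [ffun j : 'I_k.+1 => wend p.2 p.1 j].
pose h' (w : {ffun 'I_k.+1 -> X}) : X * {ffun 'I_k -> X} :=
  (w ord_max, [ffun j => w (widen_ord (leqnSn k) j)]).
rewrite (reindex h) //; exists h' => [[z w]|w] _.
  rewrite /h' /h ffunE wend_ge //=; congr pair; apply/ffunP => j.
  by rewrite !ffunE /= wend_lt.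
apply/ffunP => j; rewrite ffunE /=; have [jk|kj] := ltnP j k.
  by rewrite (wend_lt _ _ (Ordinal jk)) ffunE; congr (w _); apply: val_inj.
rewrite wend_ge //; congr (w _); apply: val_inj => /=.
by apply/eqP; rewrite eqn_leq kj -ltnS ltn_ord.
Qed.

Lemma walkE k x y : walk k x y = \sum_(w : {ffun 'I_k -> X})
  (\prod_(j < k) M j (wend w x j.+1) (wend w x j)) * (wend w x 0 == y)%:R.
Proof.
elim: k x => [|k IH] x.
  rewrite (bigD1 [ffun j : 'I_0 => x]) //= big_ord0 mul1r wend_ge // big1 ?addr0 //.
  by move=> w /eqP[]; apply/ffunP => -[].
rewrite /= big_ffun_rcons; apply: eq_bigr => z _.
rewrite IH mulr_sumr; apply: eq_bigr => w _.
set w' := [ffun j => _].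
have w'E j : (j <= k)%N -> wend w' x j = wend w z j.
  by rewrite -ltnS => jk; rewrite (wend_lt w' x (Ordinal jk)) ffunE.
rewrite big_ord_recr /= (w'E k) // (w'E 0%N) // (@wend_ge k.+1) // (@wend_ge k w _ k) //.
rewrite mulrA [M k x z * _]mulrC; congr (_ * _ * _).
by apply: eq_bigr => j _; rewrite !w'E // ltnW.
Qed.

(** Closing the walk forces x to be the vertex at time 0, so the sum over x collapses and time k
    wraps around to 0. *)
Lemma walk_closed k (k0 : (0 < k)%N) : \sum_x walk k x x =
  \sum_(w : {ffun 'I_k -> X}) \prod_(j < k) M j (cyc k0 w j.+1) (cyc k0 w j).
Proof.
under eq_bigr do rewrite walkE.
rewrite exchange_big /=; apply: eq_bigr => w _.
have w0 x : wend w x 0 = cyc k0 w 0.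
  by rewrite (wend_lt w x (Ordinal k0)) -cyc_ord.
rewrite (bigD1 (cyc k0 w 0)) //= w0 eqxx mulr1 [X in _ + X]big1 ?addr0 => [|x]; last first.
  by rewrite w0 eq_sym => /negPf->; rewrite mulr0.
apply: eq_bigr => j _; rewrite wend_lt -cyc_ord; congr (M _ _ _).
have [jk|kj] := ltnP j.+1 k; first by rewrite (wend_lt _ _ (Ordinal jk)) -cyc_ord.
rewrite wend_ge //; apply: cyc_mod.
have -> : j.+1 = k by apply/eqP; rewrite eqn_leq kj ltn_ord.
by rewrite modnn mod0n.
Qed.
End ClosedWalks.

(** The length is [k.+1] because the empty product fails: the compound of the identity vanishes on
    sets of the wrong size, while [walk 0] is 1 on the whole diagonal. *)
Lemma compound_prod (R : comNzRingType) r i (x0 : 'I_r) (A : nat -> 'M[R]_r) k I J :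
  compound i x0 (\prod_(j <- rev (iota 0 k.+1)) A j) I J =
  walk (fun j => compound i x0 (A j)) k.+1 I J.
Proof.
elim: k I J => [|k IH] I J.
  rewrite /= big_seq1 (bigD1 J) //= eqxx mulr1 big1 ?addr0 // => L /negPf->.
  by rewrite mulr0.
have -> : rev (iota 0 k.+2) = k.+1 :: rev (iota 0 k.+1).
  by rewrite -[k.+2]addn1 iotaD rev_cat.
rewrite big_cons compoundM.
by apply: eq_bigr => L _; rewrite IH.
Qed.

Lemma trace_compound_prod (R : comNzRingType) r i (x0 : 'I_r) (A : nat -> 'M[R]_r)
    k (k0 : (0 < k)%N) :
  \sum_I compound i x0 (\prod_(j <- rev (iota 0 k)) A j) I I =
  \sum_(w : {ffun 'I_k -> {set 'I_r}})
    \prod_(j < k) compound i x0 (A j) (cyc k0 w j.+1) (cyc k0 w j).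
Proof.
rewrite -(walk_closed (fun j => compound i x0 (A j))); case: k k0 => // k _.
by apply: eq_bigr => I _; rewrite compound_prod.
Qed.

(** * Coefficients of the characteristic polynomial as cyclic sums *)

Section Expansion.
Variables (S R : comNzRingType) (emb : {rmorphism S -> R}) (r i : nat) (x0 : 'I_r).
Variables (B : finType) (co : 'I_r -> 'I_r -> B -> S) (ex : B -> nat).

Definition compound_coef (I J : {set 'I_r}) (t : 'S_i * {ffun 'I_i -> B}) : S :=
  (#|I| == i)%:R * ((-1) ^+ t.1 *
    \prod_k co (set_enum x0 I k) (set_enum x0 J (t.1 k)) (t.2 k)).

Definition compound_exp (t : 'S_i * {ffun 'I_i -> B}) : nat :=
  (\sum_k ex (t.2 k))%N.

Lemma compound_expand (A : 'M[R]_r) z Q I J :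
  (forall a b, A a b = \sum_al emb (co a b al) * z ^+ (Q * ex al)) ->
  compound i x0 A I J =
    \sum_t emb (compound_coef I J t) * z ^+ (Q * compound_exp t).
Proof.
move=> AE; rewrite /compound /determinant mulr_sumr -(pair_bigA _ (fun s g =>
  emb (compound_coef I J (s, g)) * z ^+ (Q * compound_exp (s, g)))) /=.
apply: eq_bigr => s _.
under eq_bigr do rewrite mxE AE.
rewrite bigA_distr_bigA !mulr_sumr; apply: eq_bigr => g _.
rewrite big_split /= /compound_coef /compound_exp /=.
rewrite !rmorphM rmorph_nat rmorph_sign rmorph_prod -!mulrA; congr (_ * (_ * (_ * _))).
by rewrite prodrXr big_distrr.
Qed.
End Expansion.

Section CharpExpansion.
Variables (l : nat) (pl : prime l) (K : closedFieldType).
Local Notation Zl := (padic_int pl).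
Variable phi : {rmorphism {fraction Zl} -> K}.
Local Notation emb := (padic_emb phi).
Variables (zeta : nat -> K) (r i : nat) (x0 : 'I_r) (B : finType).
Variables (co : 'I_r -> 'I_r -> B -> Zl) (ex : B -> nat) (q : nat).

(** A letter is a subset together with a term of the expanded compound entry whose column is that
    subset and whose row is the subset of the next letter. *)
Lemma coef_charp_cyclic (A : nat -> 'M[K]_r) N k (k0 : (0 < k)%N) :
  (forall j a b, A j a b = \sum_al emb (co a b al) * zeta N ^+ (q ^ j * ex al)) ->
  (\det (1%:M - 'X *: map_mx polyC (\prod_(j <- rev (iota 0 k)) A j)))`_i =
    (-1) ^+ i * cyclic_sum phi zeta q
      (fun y y' : {set 'I_r} * ('S_i * {ffun 'I_i -> B}) =>
         compound_coef x0 co y'.1 y.1 y.2)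
      (fun y _ => compound_exp ex y.2) N k0.
Proof.
move=> AE; rewrite (coef_det_1sub _ x0); congr (_ * _).
rewrite trace_compound_prod /cyclic_sum.
under eq_bigr => w _.
  under eq_bigr => j _ do rewrite (compound_expand _ _ _ _ (AE j)).
  rewrite bigA_distr_bigA.
  over.
rewrite pair_bigA /=.
pose h (p : {ffun 'I_k -> {set 'I_r}} * {ffun 'I_k -> 'S_i * {ffun 'I_i -> B}}) :
  {ffun 'I_k -> {set 'I_r} * ('S_i * {ffun 'I_i -> B})} := [ffun j => (p.1 j, p.2 j)].
pose h' (y : {ffun 'I_k -> {set 'I_r} * ('S_i * {ffun 'I_i -> B})}) :
  {ffun 'I_k -> {set 'I_r}} * {ffun 'I_k -> 'S_i * {ffun 'I_i -> B}} :=
  ([ffun j => (y j).1], [ffun j => (y j).2]).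
rewrite [RHS](reindex h); last first.
  exists h' => [[w t]|y] _; last by apply/ffunP => j; rewrite !ffunE -surjective_pairing.
  by congr pair; apply/ffunP => j; rewrite !ffunE.
apply: eq_bigr => -[w t] _ /=.
rewrite /weight /phase rmorph_prod -prodrXr -big_split /=.
have hE j : cyc k0 (h (w, t)) j = (cyc k0 w j, cyc k0 t j) by rewrite /cyc ffunE.
by apply: eq_bigr => j _; rewrite !hE /= (cyc_ord k0 t).
Qed.
End CharpExpansion.

(** * Orders of scalar matrices and the congruence *)

Lemma leastE (P : set nat) k : P k -> (forall j, P j -> (k <= j)%N) -> least P = k.
Proof.
move=> Pk kP; rewrite /least; case: xgetP => [j _ [Pj jP]|/(_ k)[]//].
by apply/eqP; rewrite eqn_leq jP ?kP.
Qed.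

Section ScalarOrder.
Variables (l : nat) (pl : prime l) (b : nat) (q : padic_int pl).
Local Notation Zl := (padic_int pl).
Implicit Types v w : 'cV[Zl]_b.

Lemma scalar_mxX k : (q%:M : 'M[Zl]_b) ^+ k = (q ^+ k)%:M.
Proof.
elim: k => [|k IH]; first by rewrite !expr0.
by rewrite !exprS IH scalar_mxM.
Qed.

(** A unit coordinate of v can be divided out, so the condition bears on q alone; taking the residue
    at a level M above N lets one natural number stand for q at several levels. *)
Lemma eqmodmx_scalar N M k v : (N <= M)%N -> primitive v ->
  eqmodmx (l ^ N)%:R ((q%:M : 'M[Zl]_b) ^+ k *m v) v <->
  residue q M ^ k = 1 %[mod l ^ N].
Proof.
move=> NM [a va].
have -> : residue q M ^ k = 1 %[mod l ^ N] <-> eqmod (l ^ N)%:R (q ^+ k) 1.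
  rewrite eqmod_residue residueX (residue_nat pl 1) -(residueD q N (M - N)) subnKC //.
  by rewrite modnXm.
rewrite scalar_mxX mul_scalar_mx; split=> [E|E c j]; last first.
  by rewrite mxE -[X in eqmod _ _ X]mul1r; apply: eqmodM; last exact: eqmod_refl.
have [c] := E a 0; rewrite mxE => Ec; exists (c / v a 0).
by rewrite mulrA -Ec mulrBl mulrK // divrr.
Qed.

Lemma kminE N k : (0 < b)%N ->
  (forall v, primitive v -> kord (q%:M : 'M[Zl]_b) N v = k) -> kmin (q%:M : 'M[Zl]_b) N = k.
Proof.
move=> b0 kv; apply: leastE => [|j [v vp ->]]; last by rewrite kv.
have vp : primitive (const_mx 1 : 'cV[Zl]_b).
  by exists (Ordinal b0); rewrite mxE unitr1.
by exists (const_mx 1); rewrite ?kv.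
Qed.

Lemma kord_residue1 N M v : (N <= M)%N -> residue q M = 1%N -> primitive v ->
  kord (q%:M : 'M[Zl]_b) N v = 1%N.
Proof.
move=> NM q1 vp; apply: leastE => [|j []//]; split=> //.
by apply/(eqmodmx_scalar _ NM vp); rewrite q1.
Qed.

(** By lifting the exponent, l^N divides q^k - 1 exactly when l^(N - m) divides k, m being the
    valuation of q - 1. *)
Lemma kord_scalar (l_odd : odd l) N M v : (N <= M)%N -> primitive v ->
  residue q M = 1 %[mod l] -> (1 < residue q M)%N ->
  kord (q%:M : 'M[Zl]_b) N v = (l ^ (N - logn l (residue q M - 1)))%N.
Proof.
move=> NM vp ql q1; set m := logn l _.
have H k : (0 < k)%N ->
    eqmodmx (l ^ N)%:R ((q%:M : 'M[Zl]_b) ^+ k *m v) v <-> (l ^ (N - m) %| k)%N.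
  move=> k0; rewrite (eqmodmx_scalar _ NM vp) pfactor_dvdn // leq_subLR -dvdn_expB1 //.
  by rewrite -eqn_mod_dvd ?expn_gt0 ?(ltnW q1) //; split=> /eqP.
apply: leastE => [|j [j0 /(H j j0)/(dvdn_leq j0)]] //.
by split; [|apply/H]; rewrite ?pl_gt0.
Qed.
End ScalarOrder.

Section Evaluate.
Variables (l : nat) (pl : prime l) (l_odd : odd l) (K : closedFieldType).
Local Notation Zl := (padic_int pl).
Variable phi : {rmorphism {fraction Zl} -> K}.
Local Notation emb := (padic_emb phi).
Variable zeta : nat -> K.
Hypothesis zeta_prim : forall n : nat, (l ^ n).-primitive_root (zeta n).

Lemma integral_zeta N : integralOver emb (zeta N).
Proof.
exists ('X^(l ^ N) - 1); first by rewrite monicXnsubC // pl_gt0.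
rewrite rmorphB rmorph1 /= map_polyXn /root !hornerE.
by rewrite (prim_expr_order (zeta_prim N)) subrr.
Qed.

(** The data [co] and [ex] are common to all levels N up to M, since roots of unity of order l^N
    also satisfy x^(l^M) = 1; this makes the two characteristic polynomials comparable. *)
Lemma eval_at_expand b r (F : 'M[mpseries b Zl]_r) (q : Zl) (v : 'cV[Zl]_b) M :
  (0 < b)%N -> exists co : 'I_r -> 'I_r -> {ffun 'I_b -> 'I_(l ^ M)} -> Zl,
  exists ex : {ffun 'I_b -> 'I_(l ^ M)} -> nat, forall N j a c, (N <= M)%N ->
    eval_at phi zeta F N (q%:M ^+ j *m v) a c =
      \sum_al emb (co a c al) * zeta N ^+ (residue q M ^ j * ex al).
Proof.
move=> b0.
have /choice[co coP] : forall p : 'I_r * 'I_r, exists co, forall z (x : 'I_b -> K),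
    integralOver emb z -> (forall i, x i ^+ (l ^ M) = 1) ->
    (forall i, adjoin_int phi z (x i)) ->
    mpseries_eval phi z (F p.1 p.2) (fun i => x i - 1) =
      \sum_(al : {ffun 'I_b -> 'I_(l ^ M)}) emb (co al) * \prod_i x i ^+ al i.
  by move=> p; apply: mpseries_expand.
exists (fun a c => co (a, c)), (fun al : {ffun 'I_b -> 'I_(l ^ M)} => \sum_m residue (v m 0%R) M * al m)%N.
move=> N j a c NM; rewrite mxE (coP (a, c)) //; first last.
- by move=> m; apply: adjoinX; apply: adjoin_gen.
- move=> m; rewrite /zeta_pow exprAC -(subnKC NM) expnD exprM.
  by rewrite (prim_expr_order (zeta_prim N)) !expr1n.
- exact: integral_zeta.
apply: eq_bigr => al _; congr (_ * _).
rewrite big_distrr /= -prodrXr; apply: eq_bigr => m _.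
rewrite /zeta_pow -exprM; apply: zeta_mod => //.
rewrite scalar_mxX mul_scalar_mx mxE residueM residueX.
have rM (x : Zl) : residue x N = (residue x M %% l ^ N)%N.
  by rewrite -(residueD x N (M - N)) subnKC.
rewrite modnMml -mulnA modnMml -[LHS]modnMm -[RHS]modnMm; congr ((_ * _) %% _)%N.
  by rewrite rM modnXm.
by rewrite rM modnMml.
Qed.
End Evaluate.

Theorem theorem3p3 (l : nat) (pl : prime l) (l_odd : odd l)
    (b r : nat) (b_ge1 : (1 <= b)%N) (r_ge1 : (1 <= r)%N)
    (K : closedFieldType) (phi : {rmorphism {fraction padic_int pl} -> K})
    (K_clos : algebraic_closure phi)
    (zeta : nat -> K)
    (zeta_prim : forall n : nat, (l ^ n).-primitive_root (zeta n))
    (zeta_compat : forall n : nat, zeta n.+1 ^+ l = zeta n)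
    (F : 'M[mpseries b (padic_int pl)]_r) (F_GL : F \in unitmx)
    (Q : 'M[padic_int pl]_b) (Q_GL : Q \in unitmx)
    (Q_cong : eqmodmx l%:R Q 1%:M)
    (Q_fix : forall w : 'cV[padic_int pl]_b, Q *m w = w -> w = 0)
    (q : padic_int pl) (q_cong : eqmod l%:R q 1) (q_neq1 : q <> 1)
    (Q_scalar : Q = q%:M)
    (v : 'cV[padic_int pl]_b) (v_prim : primitive v)
    (n : nat) (k_step : kmin Q n.+1 = (l * kmin Q n)%N) :
  forall i : nat,
    exists2 c : K, adjoin_int phi (zeta n.+1) c
      & (charp phi zeta F Q n.+1 v - charp phi zeta F Q n v)`_i
        = (kmin Q n.+1)%:R * c.
Proof.
move=> i; subst Q; clear Q_GL Q_cong Q_fix F_GL K_clos.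
set M := n.+1; set q0 := residue q M.
have nM : (n <= M)%N by rewrite leqnSn.
have q0l : q0 = 1 %[mod l].
  have /eqmod_residue1 := q_cong; rewrite (residue_nat pl 1) -(residueD q 1 n) add1n.
  by rewrite !expn1.
(* If q0 were 1, both minima would be 1 and [k_step] would read 1 = l; q0 = 0 contradicts q = 1
   modulo l. *)
have [q0_gt1|] := ltnP 1 q0; last first.
  rewrite leq_eqVlt ltnS leqn0 => /orP[/eqP q1|/eqP q00]; exfalso; last first.
    by move: q0l; rewrite q00 mod0n modn_small ?prime_gt1.
  move: k_step; rewrite (kminE b_ge1 (fun v => kord_residue1 (leqnn M) q1 (v := v))).
  rewrite (kminE b_ge1 (fun v => kord_residue1 nM q1 (v := v))) muln1 => l1.
  by have := prime_gt1 pl; rewrite -l1.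
have q0_lt : (q0 < l ^ M)%N by rewrite /q0 -(residue_mod q M) ltn_pmod // pl_gt0.
set m := logn l (q0 - 1).
have m_gt0 : (0 < m)%N.
  rewrite -pfactor_dvdn ?subn_gt0 // expn1 -eqn_mod_dvd ?(ltnW q0_gt1) //; exact/eqP.
(* The number q0 - 1 is positive and below l^(n+1), so its valuation is at most n. *)
have mn : (m <= n)%N.
  rewrite -ltnS ltnNge -pfactor_dvdn ?subn_gt0 //; apply/negP => /dvdn_leq.
  by rewrite subn_gt0 q0_gt1 leqNgt (leq_ltn_trans (leq_subr _ _)) // => /(_ isT).
pose s := (n - m)%N.
have kn (w : 'cV_b) : primitive w -> kord q%:M n w = (l ^ s)%N by move=> wp; rewrite (kord_scalar l_odd nM wp).
have kM (w : 'cV_b) : primitive w -> kord q%:M M w = (l ^ s.+1)%N.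
  by move=> wp; rewrite (kord_scalar l_odd (leqnn M) wp) // subSn.
rewrite (kminE b_ge1 kM) coefB /charp /Amx kn // kM //.
have [co [ex coP]] := eval_at_expand l_odd phi zeta_prim F q v M b_ge1.
have x0 : 'I_r := Ordinal r_ge1.
rewrite (coef_charp_cyclic i x0 (pl_gt0 pl s.+1) (fun j a c => coP M j a c (leqnn M))).
rewrite (coef_charp_cyclic i x0 (pl_gt0 pl s) (fun j a c => coP n j a c nM)) -mulrBr.
have msn : (m + s = n)%N by rewrite subnKC.
have [x xz] := cyclic_sum_congr l_odd phi zeta_prim zeta_compat m_gt0 q0_gt1 (erefl m)
  (fun y y' : {set 'I_r} * ('S_i * {ffun 'I_i -> {ffun 'I_b -> 'I_(l ^ M)}}) =>
     compound_coef x0 co y'.1 y.1 y.2)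
  (fun y _ => compound_exp ex y.2) (pl_gt0 pl s) (pl_gt0 pl s.+1).
rewrite msn => ->; exists ((-1) ^+ i * x); last by rewrite mulrCA.
apply: adjoinM; last by move: xz; rewrite msn.
by rewrite -(rmorph_sign (padic_emb phi)); apply: adjoin_emb.
Qed.
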